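(* Let $H$ be a subspace of ${\cal A}_h$ that is closed in the norm topology of ${\cal A}$. Then $M=e^H=\{e^h: h\in H\}$ is a geodesically convex subset of $\Sigma$ if and only if $[x,[x,y]]\in H$ for any $x,y\in H$.
   Context: ${\cal A}$ is a von Neumann algebra with a finite, normal, faithful tracial state $\tau$; ${\cal A}_h$ is the real space of selfadjoint elements of ${\cal A}$; $\Sigma=e^{{\cal A}_h}$ is the set of positive invertible elements of ${\cal A}$. For $p,q\in\Sigma$ the geodesic of $\Sigma$ joining $p$ to $q$ is $\delta_{p,q}(t)=p^{1/2}\left(p^{-1/2}qp^{-1/2}\right)^t p^{1/2}$. A subset $M\subset\Sigma$ is (geodesically) convex if $\delta_{p,q}(t)\in M$ for all $p,q\in M$ and all values of $t$ (all real $t$). $[x,y]=xy-yx$ is the commutator. ''Subspace'' means real linear subspace. *)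

(* Defs.v *)
From HB Require Import structures.
From mathcomp Require Import all_boot all_order all_algebra.
From mathcomp Require Import complex.
From mathcomp Require Import boolp classical_sets functions reals topology.
From mathcomp Require Import normedtype sequences.

Set Implicit Arguments.
Unset Strict Implicit.
Unset Printing Implicit Defensive.
Import Order.TTheory GRing.Theory Num.Theory.
Import numFieldNormedType.Exports.

Local Open Scope classical_set_scope.
Local Open Scope ring_scope.
Local Open Scope complex_scope.

Section BoundedOperators.
Variables (R : realType) (V : normedModType R[i]).
Implicit Types f g : V -> V.

Let realD (a b : R) : (a + b)%:C = a%:C + b%:C.
Proof. exact: rmorphD. Qed.

Let realM (a b : R) : (a * b)%:C = a%:C * b%:C.
Proof. exact: rmorphM. Qed.

Let ReK (c : R[i]) : 0 <= c -> (complex.Re c)%:C = c.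
Proof. by move=> c0; rewrite RRe_real// ger0_real. Qed.

Definition bounded_linear_op : {pred V -> V} := fun f =>
  `[< linear f /\ exists c : R, forall v, `|f v| <= c%:C * `|v| >].

Record bop : Type := Bop {
  bop_fun :> V -> V ;
  bop_subproof : bounded_linear_op bop_fun
}.

HB.instance Definition _ := [isSub for bop_fun].
HB.instance Definition _ := [Choice of bop by <:].

Fact bounded_linear_op_submod : GRing.subsemimod_closed bounded_linear_op.
Proof.
split; first split.
- apply/asboolP; split.
    by move=> a u v; rewrite -[LHS]/(0 : V) -[RHS]/(a *: 0 + 0 : V) scaler0 addr0.
  by exists 0 => v; rewrite normr0 mul0r.
- move=> f g /asboolP[lf [c cf]] /asboolP[lg [d dg]]; apply/asboolP; split.
    move=> a u v; rewrite !fctE lf lg scalerDr -!addrA; congr (_ + _).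
    by rewrite addrCA.
  exists (c + d) => v; rewrite (le_trans (ler_normD _ _))//.
  by rewrite realD mulrDl lerD.
- move=> a f /asboolP[lf [c cf]]; apply/asboolP; split.
    by move=> b u v; rewrite !fctE lf scalerDr !scalerA mulrC.
  exists (complex.Re `|a| * c) => v.
  by rewrite normrZ realM ReK// -mulrA ler_wpM2l.
Qed.

HB.instance Definition _ :=
  GRing.SubChoice_isSubLmodule.Build R[i] (V -> V) bounded_linear_op bop
    bounded_linear_op_submod.

Implicit Types x y z : bop.

Lemma bopP x y : (forall v, x v = y v) <-> x = y.
Proof. by split=> [xy|->//]; apply/val_inj/funext. Qed.

Fact bop_is_linear x : linear x.
Proof. by have /asboolP[] := bop_subproof x. Qed.

HB.instance Definition _ x :=
  GRing.isLinear.Build R[i] V V *:%R (bop_fun x) (bop_is_linear x).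

Fact bop_one_subproof : bounded_linear_op (@id V).
Proof. by apply/asboolP; split=> //; exists 1 => v; rewrite mul1r. Qed.

Fact bop_mul_subproof x y : bounded_linear_op (x \o y).
Proof.
apply/asboolP; split=> [a u v /=|]; first by rewrite !linearP.
have /asboolP[_ [c cx]] := bop_subproof x.
have /asboolP[_ [d dy]] := bop_subproof y.
exists (`|c| * d) => v /=; apply: le_trans (cx _) _.
rewrite realM -mulrA.
apply: (@le_trans _ _ (`|c|%:C * `|y v|)).
  by rewrite ler_wpM2r// lecR ler_norm.
by rewrite ler_wpM2l// ler0c.
Qed.

Definition bop_one := Bop bop_one_subproof.
Definition bop_mul x y := Bop (bop_mul_subproof x y).

Fact bop_mulA : associative bop_mul.
Proof. by move=> x y z; apply/bopP. Qed.
Fact bop_mul1 : left_id bop_one bop_mul.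
Proof. by move=> x; apply/bopP. Qed.
Fact bop_mulr1 : right_id bop_one bop_mul.
Proof. by move=> x; apply/bopP. Qed.
Fact bop_mulDl : left_distributive bop_mul +%R.
Proof. by move=> x y z; apply/bopP. Qed.
Fact bop_mulDr : right_distributive bop_mul +%R.
Proof. by move=> x y z; apply/bopP => v; exact: linearD. Qed.

HB.instance Definition _ := GRing.Zmodule_isPzRing.Build bop
  bop_mulA bop_mul1 bop_mulr1 bop_mulDl bop_mulDr.

Definition opnorm x : R :=
  sup [set complex.Re `|x v| | v in [set v | `|v| <= 1]].

Fact opnorm_has_sup x : has_sup [set complex.Re `|x v| | v in [set v | `|v| <= 1]].
Proof.
split; first by exists (complex.Re `|x 0|), 0 => //=; rewrite normr0.
have /asboolP[_ [c cx]] := bop_subproof x.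
exists `|c| => _ [v /= v1 <-]; rewrite -lecR ReK// (le_trans (cx v))//.
apply: (@le_trans _ _ (`|c|%:C * `|v|)).
  by rewrite ler_wpM2r// lecR ler_norm.
by rewrite ler_piMr// ler0c.
Qed.

Fact opnorm_ge0 x : 0 <= opnorm x.
Proof.
have [_ ub] := opnorm_has_sup x.
apply: ub_le_sup => //; exists 0; first by rewrite /= normr0.
by rewrite linear0 normr0.
Qed.

Lemma le_opnorm x v : `|x v| <= (opnorm x)%:C * `|v|.
Proof.
have [->|v0] := eqVneq v 0; first by rewrite linear0 !normr0 mulr0.
have nv0 : 0 < `|v| by rewrite normr_gt0.
rewrite -ler_pdivrMr// mulrC -{1}(ger0_norm (ltW nv0)) -normfV -normrZ -linearZ.
rewrite -[`|_|]ReK// lecR; have [_ ub] := opnorm_has_sup x.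
apply: ub_le_sup => //; exists (`|v|^-1 *: v) => //=.
by rewrite normrZ normfV normr_id mulVf// gt_eqF.
Qed.

Lemma opnorm_le x (c : R) :
  0 <= c -> (forall v, `|x v| <= c%:C * `|v|) -> opnorm x <= c.
Proof.
move=> c0 cx; have [ne _] := opnorm_has_sup x.
apply: ge_sup => // _ [v /= v1 <-]; rewrite -lecR ReK//.
by rewrite (le_trans (cx v))// ler_piMr// ler0c.
Qed.

Fact opnormD x y : (opnorm (x + y))%:C <= (opnorm x)%:C + (opnorm y)%:C.
Proof.
rewrite -realD lecR.
apply: opnorm_le => [|v]; first by rewrite addr_ge0// opnorm_ge0.
rewrite realD mulrDl.
by rewrite (le_trans (ler_normD (x v) (y v)))// lerD// le_opnorm.
Qed.

Fact opnormZ_le (a : R[i]) x : opnorm (a *: x) <= complex.Re `|a| * opnorm x.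
Proof.
apply: opnorm_le => [|v].
  by apply: mulr_ge0; [rewrite -lecR ReK//; exact: normr_ge0|exact: opnorm_ge0].
rewrite realM ReK// -mulrA.
by rewrite [leLHS](normrZ a (x v)) ler_wpM2l// le_opnorm.
Qed.

Fact opnormZ (a : R[i]) x : (opnorm (a *: x))%:C = `|a| * (opnorm x)%:C.
Proof.
have le b y : (opnorm (b *: y))%:C <= `|b| * (opnorm y)%:C.
  by rewrite -[`|_|]ReK// -realM lecR opnormZ_le.
apply/eqP; rewrite eq_le le/=.
have [->|a0] := eqVneq a 0; first by rewrite normr0 mul0r ler0c opnorm_ge0.
rewrite -{1}(scalerK a0 x) -ler_pdivlMl ?normr_gt0// -normfV; exact: le.
Qed.

Fact opnorm0_eq0 x : (opnorm x)%:C = 0 -> x = 0.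
Proof.
move=> x0; apply/bopP => v; apply/eqP; rewrite -[_ == _]normr_le0.
by rewrite (le_trans (le_opnorm x v))// x0 mul0r.
Qed.

HB.instance Definition _ := Lmodule_isNormed.Build R[i] bop
  opnormD opnormZ opnorm0_eq0.

End BoundedOperators.

(* Real scalars act on [bop V] through [_%:C]; [dot] is linear in its first
   variable. *)
Section VonNeumannAlgebras.
Variables (R : realType) (V : completeNormedModType R[i]).
Variable dot : {dot V for @Num.conj R[i]}.
Implicit Types (x y p q s h : bop V) (A D H M : set (bop V)) (t : R).

Definition hilbert_norm : Prop := forall v, `|v| ^+ 2 = dot v v.

Definition adjoint x y : Prop := forall u v, dot (x u) v = dot u (y v).

Definition positive x : Prop := forall v, 0 <= dot (x v) v.

Definition op_le x y : Prop := positive (y - x).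

(* Weak operator topology: a basic neighbourhood of [x] is given by finitely
   many pairs of vectors and a positive real. *)
Definition wot_closed A : Prop := forall x,
  (forall (s : seq (V * V)) (e : R), 0 < e ->
     exists2 y, A y & forall uv, uv \in s ->
       `|dot ((x - y) uv.1) uv.2| < e%:C) ->
  A x.

Record von_neumann_algebra A : Prop := {
  vN_one : A 1 ;
  vN_add : forall x y, A x -> A y -> A (x + y) ;
  vN_scale : forall (c : R[i]) x, A x -> A (c *: x) ;
  vN_mul : forall x y, A x -> A y -> A (x * y) ;
  vN_adjoint : forall x, A x -> exists2 y, A y & adjoint x y ;
  vN_wot_closed : wot_closed A
}.

Definition selfadjoint A : set (bop V) := [set x | A x /\ adjoint x x].

Definition upward_directed D : Prop :=
  forall x y, D x -> D y -> exists2 z, D z & op_le x z /\ op_le y z.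

Definition is_lub A D s : Prop :=
  [/\ selfadjoint A s, forall x, D x -> op_le x s &
      forall y, selfadjoint A y -> (forall x, D x -> op_le x y) -> op_le s y].

(* Only the restriction of [tau] to [A] is meaningful; it is real-valued on
   selfadjoint elements. *)
Record normal_faithful_tracial_state A (tau : bop V -> R[i]) : Prop := {
  state_linear : forall (c : R[i]) x y, A x -> A y ->
    tau (c *: x + y) = c * tau x + tau y ;
  state_ge0 : forall x, A x -> positive x -> 0 <= tau x ;
  state_one : tau 1 = 1 ;
  state_trace : forall x y, A x -> A y -> tau (x * y) = tau (y * x) ;
  state_faithful : forall x, A x -> positive x -> tau x = 0 -> x = 0 ;
  state_normal : forall D s, D !=set0 -> D `<=` selfadjoint A ->
    upward_directed D -> is_lub A D s ->
    complex.Re (tau s) = sup [set complex.Re (tau x) | x in D]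
}.

Definition op_exp x : bop V :=
  limn (series (fun k : nat => (k`!%:R : R[i])^-1 *: x ^+ k)).

Definition Sigma A : set (bop V) := op_exp @` selfadjoint A.

(* The selfadjoint logarithm; it is unique when it exists, and [0] is a dummy
   value otherwise. *)
Definition op_log p : bop V :=
  xget 0 [set h | adjoint h h /\ op_exp h = p].

Definition op_pow p t : bop V := op_exp (t%:C *: op_log p).

Definition geodesic p q t : bop V :=
  op_pow p 2^-1 * op_pow (op_pow p (- 2^-1) * q * op_pow p (- 2^-1)) t
  * op_pow p 2^-1.

Definition geodesically_convex A M : Prop :=
  M `<=` Sigma A /\ forall p q, M p -> M q -> forall t, M (geodesic p q t).

Definition commutator x y : bop V := x * y - y * x.

Definition real_subspace H : Prop :=
  [/\ H 0, forall x y, H x -> H y -> H (x + y) &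
      forall t x, H x -> H (t%:C *: x)].

End VonNeumannAlgebras.

(* Main.v *)
From HB Require Import structures.
Require Import Defs.
From mathcomp Require Import all_boot all_order all_algebra.
From mathcomp Require Import complex.
From mathcomp Require Import boolp classical_sets functions reals topology.
From mathcomp Require Import normedtype sequences.
From mathcomp Require Import exp ring lra.
Import Order.TTheory GRing.Theory Num.Theory.
Import numFieldNormedType.Exports.
Local Open Scope classical_set_scope.
Local Open Scope ring_scope.
Local Open Scope complex_scope.
Set Implicit Arguments.
Unset Strict Implicit.
Unset Printing Implicit Defensive.

(** The geodesic joining e^x to e^y is t |-> e^(x/2) e^(t z) e^(x/2), where
    e^z = e^(-x/2) e^y e^(-x/2); starting at e^(-y) and ending at e^x, it passes
    at t = 2 through e^x e^y e^x. So e^H is geodesically convex if and only if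
    it is stable under (p, q) |-> p q p, and the double commutator condition is
    the infinitesimal form of that stability.

    The link is the derivative of the exponential: at 2k, in the direction w, it
    is e^k S_k(w) e^k, where S_k = sinh (ad k) / ad k ([sinhc],
    [op_exp_taylor]). Both S_k and cosh (ad k) are even power series in ad k, so
    they preserve a closed subspace stable under double commutators.

    Suppose first that H is stable under double commutators. The curve
    g(t) = log (e^(t x) e^y e^(t x)) solves g' = S_k^-1 (2 cosh (ad k) x) with
    k = g/2, and this vector field is tangent to H because S_k maps H onto H
    ([sinhc_onto]). Euler polygons starting at y therefore stay in H, their
    exponentials converge to e^x e^y e^x ([euler_polygon]), and the polygons
    themselves converge because log is Lipschitz on operators that are bounded
    away from 0 ([log_lip]); the limit lies in H, which gives [exp_sandwich].
    The Lipschitz bound also makes the selfadjoint logarithm unique and bounds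
    S_k below, which is what lets the surjectivity of S_0 = 1 propagate to S_k.

    Conversely, let e^H be convex. The space of all selfadjoint operators is
    stable under double commutators, so by the first part the logarithm that
    occurs in the geodesic exists, and e^H is stable under (p, q) |-> p q p
    ([convex_sandwich]). Differentiating log (e^k e^(t y) e^k) at t = 0 shows
    that S_k^-1 maps H into H ([sinhc_preimage]). With k = s x the expansion
    S_k = 1 + s^2 (ad x)^2 / 6 + O(s^3) then exhibits [x, [x, y]] as a limit of
    elements of H ([sandwich_triple]). *)

(** * Real-valued norms and dominated series *)

Section RealNorm.
Variables (R : realType) (E : normedModType R[i]).
Implicit Types (u v : E) (t : R).

(** The norm of a space over [R[i]] takes values in [R[i]]; its real part carries
    the same information and can be compared with real exponentials. *)
Definition rnorm v : R := complex.Re `|v|.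

Lemma rnormE v : (rnorm v)%:C = `|v|.
Proof. by rewrite /rnorm RRe_real// ger0_real. Qed.

Lemma rnorm_ge0 v : 0 <= rnorm v.
Proof. by rewrite -lecR rnormE normr_ge0. Qed.

Lemma rnormD u v : rnorm (u + v) <= rnorm u + rnorm v.
Proof. by rewrite -lecR raddfD /= !rnormE ler_normD. Qed.

Lemma rnormN v : rnorm (- v) = rnorm v.
Proof. by rewrite /rnorm normrN. Qed.

Lemma rnormB u v : rnorm (u - v) <= rnorm u + rnorm v.
Proof. by rewrite -(rnormN v) rnormD. Qed.

Lemma rnormC u v : rnorm (u - v) = rnorm (v - u).
Proof. by rewrite -rnormN opprB. Qed.

Lemma rnorm0 : rnorm (0 : E) = 0.
Proof. by rewrite /rnorm normr0. Qed.

Lemma rnorm_le0 v : rnorm v <= 0 -> v = 0.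
Proof. by rewrite -lecR rnormE normr_le0 => /eqP. Qed.

Lemma normCR t : `|t%:C| = `|t|%:C :> R[i].
Proof. by rewrite normc_def /= expr0n addr0 sqrtr_sqr. Qed.

Lemma rnormZ t v : rnorm (t%:C *: v) = `|t| * rnorm v.
Proof. by apply: (@complexI R); rewrite rmorphM /= !rnormE normrZ normCR. Qed.

Lemma rnormMn v n : rnorm (v *+ n) = n%:R * rnorm v.
Proof. by apply: (@complexI R); rewrite rmorphM /= !rnormE normrMn rmorph_nat mulr_natl. Qed.

Lemma rnorm_sum (I : Type) (r : seq I) (F : I -> E) :
  rnorm (\sum_(i <- r) F i) <= \sum_(i <- r) rnorm (F i).
Proof.
elim: r => [|i r IH]; first by rewrite !big_nil rnorm0.
by rewrite !big_cons (le_trans (rnormD _ _))// lerD2l.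
Qed.

Lemma cvg_rnormP (u : nat -> E) (l : E) :
  u @ \oo --> l <-> (fun n => rnorm (u n - l)) @ \oo --> (0 : R).
Proof.
split=> [/cvgrPdist_le h|/cvgrPdist_le h]; apply/cvgrPdist_le.
  move=> e e0; have := h e%:C; rewrite ltcR => /(_ e0); apply: filterS => n.
  by rewrite -rnormE lecR rnormC sub0r normrN ger0_norm ?rnorm_ge0.
move=> e e0; have er : e = (complex.Re e)%:C by rewrite RRe_real// gtr0_real.
have := h (complex.Re e); rewrite -ltcR -er => /(_ e0); apply: filterS => n.
by rewrite er -rnormE lecR rnormC sub0r normrN ger0_norm ?rnorm_ge0.
Qed.

Lemma cvg_rnorm_squeeze (u : nat -> E) (l : E) (e : nat -> R) :
  (forall n, rnorm (u n - l) <= e n) -> e @ \oo --> (0 : R) -> u @ \oo --> l.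
Proof.
move=> ue e0; apply/cvg_rnormP.
apply: (squeeze_cvgr _ (cvg_cst 0) e0).
by apply: nearW => n; rewrite rnorm_ge0 ue.
Qed.

Lemma rnorm_lim_le (u : nat -> E) (l : E) (c : R) :
  u @ \oo --> l -> (forall n, rnorm (u n) <= c) -> rnorm l <= c.
Proof.
move=> /cvg_rnormP ul uc; rewrite -[rnorm l]subr0.
have : (fun n => rnorm l - rnorm (u n - l)) @ \oo --> rnorm l - 0.
  by apply: cvgB => //; exact: cvg_cst.
move=> h; apply: (cvgr_to_le h).
apply: nearW => n; rewrite lerBlDr -[X in rnorm X <= _](subrK (u n)).
by rewrite (le_trans (rnormD _ _))// rnormC addrC lerD2r.
Qed.

End RealNorm.

Lemma rnorm_complete (R : realType) (E : completeNormedModType R[i])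
    (u : nat -> E) (b : nat -> R) :
  (forall n m, (n <= m)%N -> rnorm (u m - u n) <= b n) -> b @ \oo --> (0 : R) ->
  cvg (u @ \oo).
Proof.
move=> ub b0; apply/cauchy_cvgP/cauchyP => e e0.
have er : e = (complex.Re e)%:C by rewrite RRe_real// gtr0_real.
have r0 : 0 < complex.Re e by rewrite -ltcR -er.
have [N _ hN] : \forall n \near \oo, b n < complex.Re e by exact: (cvgr_lt 0).
exists (u N); exists N => // m /= Nm.
rewrite -ball_normE /= er -rnormE ltcR rnormC.
by apply: le_lt_trans (hN N (leqnn _)); exact: ub.
Qed.

Section Sums.
Variables (R : realType) (E : completeNormedModType R[i]).
Implicit Types (a : nat -> E) (b : nat -> R) (s : E) (t : R).

(** Relational sums, so that an identity between series is proved by comparing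
    terms, convergence being carried along. *)
Definition sums a s : Prop := series a @ \oo --> s.
Definition rsums b t : Prop := series b @ \oo --> t.

Lemma sums_lim a s : sums a s -> limn (series a) = s.
Proof. by move=> h; apply: cvg_lim. Qed.

Lemma sums_unique a s s' : sums a s -> sums a s' -> s = s'.
Proof. by move=> /sums_lim <- /sums_lim <-. Qed.

Lemma sums_ext a a' s : a =1 a' -> sums a s -> sums a' s.
Proof. by move=> /funext ->. Qed.

Lemma rnorm_series_le a b m n : (m <= n)%N ->
  (forall k, rnorm (a k) <= b k) ->
  rnorm (series a n - series a m) <= series b n - series b m.
Proof.
move=> mn ab; rewrite !sub_series_geq//.
by rewrite (le_trans (rnorm_sum _ _))// ler_sum.
Qed.

Lemma rsums_tail b t : (forall k, 0 <= b k) -> rsums b t ->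
  forall n, series b n <= t.
Proof.
move=> b0 bt n; rewrite -(cvg_lim _ bt)//; apply: nondecreasing_cvgn_le.
  by apply/nondecreasing_seqP => k; rewrite seriesSr lerDl.
by apply/cvg_ex; exists t.
Qed.

Lemma dominated_sums a b t : (forall k, rnorm (a k) <= b k) -> rsums b t ->
  exists2 s, sums a s & rnorm s <= t.
Proof.
move=> ab bt; have b0 k : 0 <= b k by rewrite (le_trans (rnorm_ge0 _) (ab k)).
have tail := rsums_tail b0 bt.
have : cvg (series a @ \oo).
  apply: (@rnorm_complete _ _ _ (fun n => t - series b n)).
    move=> n m nm; rewrite (le_trans (rnorm_series_le nm ab))// lerD2r.
    exact: tail.
  by rewrite -(subrr t); apply: cvgB => //; exact: cvg_cst.
move=> /cvg_ex[s as_]; exists s => //.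
apply: (rnorm_lim_le as_) => n; rewrite -[series a n]subr0.
have -> : 0 = series a 0 by rewrite /series /= big_geq.
rewrite (le_trans (rnorm_series_le (leq0n n) ab))//.
by rewrite {2}/series /= big_geq// subr0.
Qed.

Lemma sums_le a b s t : sums a s -> rsums b t ->
  (forall k, rnorm (a k) <= b k) -> rnorm s <= t.
Proof.
by move=> sa bt ab; have [s' sa' s't] := dominated_sums ab bt; rewrite (sums_unique sa sa').
Qed.

Lemma sumsD a a' s s' : sums a s -> sums a' s' -> sums (fun k => a k + a' k) (s + s').
Proof.
move=> h h'; rewrite /sums.
have -> : series (fun k => a k + a' k) = series a \+ series a'.
  by apply/funext => n; rewrite /series /= big_split.
exact: cvgD.
Qed.

Lemma sumsZ (c : R[i]) a s : sums a s -> sums (fun k => c *: a k) (c *: s).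
Proof.
move=> h; rewrite /sums.
have -> : series (fun k => c *: a k) = (fun n => c *: series a n).
  by apply/funext => n; rewrite /series /= scaler_sumr.
exact: cvgZl_tmp.
Qed.

Lemma sumsN a s : sums a s -> sums (fun k => - a k) (- s).
Proof.
by move=> /(@sumsZ (-1) _ _); rewrite scaleN1r; apply: sums_ext => k; rewrite scaleN1r.
Qed.

Lemma sumsB a a' s s' : sums a s -> sums a' s' -> sums (fun k => a k - a' k) (s - s').
Proof. by move=> h /sumsN h'; exact: sumsD. Qed.

Lemma sums_shift (a : nat -> E) s : sums (fun k => a k.+1) s -> sums a (a 0%N + s).
Proof.
move=> h; rewrite /sums -(cvg_shiftS (series a)).
rewrite [X in X @ _](_ : _ = (fun n => a 0%N + series (fun k => a k.+1) n)); last first.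
  by apply/funext => n; rewrite /series /= big_nat_recl.
by apply: cvgD h; exact: cvg_cst.
Qed.

Lemma rsums_shift b t : rsums (fun k => b k.+1) t -> rsums b (b 0%N + t).
Proof.
move=> h; rewrite /rsums -(cvg_shiftS (series b)).
rewrite [X in X @ _](_ : _ = (fun n => b 0%N + series (fun k => b k.+1) n)); last first.
  by apply/funext => n; rewrite /series /= big_nat_recl.
by apply: cvgD h; exact: cvg_cst.
Qed.

End Sums.

(** * The Banach algebra of bounded operators *)

Section BopNorm.
Variables (R : realType) (W : normedModType R[i]).
Implicit Types x y : bop W.

Lemma rnorm_apply x v : rnorm (x v) <= rnorm x * rnorm v.
Proof. by rewrite -lecR rmorphM /= !rnormE; exact: le_opnorm. Qed.

Lemma rnorm_bop_le x (c : R) : 0 <= c ->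
  (forall v, rnorm (x v) <= c * rnorm v) -> rnorm x <= c.
Proof.
by move=> c0 xc; apply: opnorm_le => // v; rewrite -!rnormE -rmorphM lecR.
Qed.

Lemma rnormM x y : rnorm (x * y) <= rnorm x * rnorm y.
Proof.
apply: rnorm_bop_le => [|v]; first by rewrite mulr_ge0 ?rnorm_ge0.
rewrite -mulrA (le_trans (rnorm_apply x (y v)))// ler_wpM2l ?rnorm_ge0//.
exact: rnorm_apply.
Qed.

Lemma rnorm1_le : rnorm (1 : bop W) <= 1.
Proof. by apply: rnorm_bop_le => // v; rewrite mul1r. Qed.

Lemma rnormX x n : rnorm (x ^+ n) <= rnorm x ^+ n.
Proof.
elim: n => [|n IH]; first by rewrite !expr0 rnorm1_le.
by rewrite !exprS (le_trans (rnormM _ _))// ler_wpM2l ?rnorm_ge0.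
Qed.

Lemma bop_scalerAl (c : R[i]) x y : c *: (x * y) = c *: x * y.
Proof. by apply/bopP. Qed.

Lemma bop_scalerAr (c : R[i]) x y : c *: (x * y) = x * (c *: y).
Proof. by apply/bopP => v; rewrite [RHS]linearZ. Qed.

Lemma bop_exprZn (c : R[i]) x n : (c *: x) ^+ n = c ^+ n *: x ^+ n.
Proof.
elim: n => [|n IH]; first by rewrite !expr0 scale1r.
by rewrite !exprS IH -bop_scalerAl -bop_scalerAr scalerA.
Qed.

End BopNorm.

Section BopComplete.
Variables (R : realType) (W : completeNormedModType R[i]).
Implicit Types x y : bop W.

Lemma bop_seq_complete (x : nat -> bop W) (b : nat -> R) :
  (forall n m, (n <= m)%N -> rnorm (x m - x n) <= b n) -> b @ \oo --> (0 : R) ->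
  exists l : bop W, forall n, rnorm (l - x n) <= b n.
Proof.
move=> xb b0.
have b_ge0 n : 0 <= b n by rewrite (le_trans (rnorm_ge0 _) (xb n n _)).
have xv v n m : (n <= m)%N -> rnorm (x m v - x n v) <= b n * rnorm v.
  move=> nm; rewrite (le_trans (rnorm_apply (x m - x n) v))//.
  by rewrite ler_wpM2r ?rnorm_ge0// xb.
have /choice[l hl] v : exists l : W, x^~ v @ \oo --> l.
  apply/cvg_ex/(rnorm_complete (xv v)).
  by rewrite -(mul0r (rnorm v)); apply: cvgM => //; exact: cvg_cst.
have lx v n : rnorm (l v - x n v) <= b n * rnorm v.
  apply: (@rnorm_lim_le _ _ (fun m => x (n + m)%N v - x n v)) => [|m].
    apply: cvgB; last exact: cvg_cst.
    have := hl v; rewrite -(cvg_shiftn n) => h; apply: cvg_trans h.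
    by apply: near_eq_cvg; near=> m; rewrite addnC.
  by apply: xv; rewrite leq_addr.
have lin_l : linear l.
  move=> a u v.
  have h : (fun m => x m (a *: u + v)) @ \oo --> a *: l u + l v.
    have -> : (fun m => x m (a *: u + v)) = (fun m => a *: x m u + x m v).
      by apply/funext => m; rewrite linearP.
    by apply: cvgD (hl v); apply: cvgZl_tmp; exact: hl.
  by rewrite -(cvg_lim _ (hl (a *: u + v)))// (cvg_lim _ h).
have bnd_l : bounded_linear_op l.
  apply/asboolP; split => //; exists (rnorm (x 0%N) + b 0%N) => v.
  rewrite -!rnormE -rmorphM lecR mulrDl -[l v](subrK (x 0%N v)) addrC.
  by rewrite (le_trans (rnormD _ _))// lerD// rnorm_apply.
exists (Bop bnd_l) => n; apply: rnorm_bop_le => // v; exact: lx.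
Unshelve. all: by end_near. Qed.

(** Completeness makes [bop (bop V)] a Banach algebra as well: exponentials of
    multiplication operators and of [ad] live there. *)
Fact bop_complete (F : set_system (bop W)) :
  ProperFilter F -> cauchy F -> cvg F.
Proof.
move=> FF /cauchyP Fc.
have p n : 0 < (2^-1 ^+ n : R) by rewrite exprn_gt0// invr_gt0.
have /choice[x hx] n : exists x, F (ball x ((2^-1 ^+ n : R)%:C)).
  by apply: Fc; rewrite ltcR.
have ballE (c y : bop W) (e : R) : ball c e%:C y -> rnorm (c - y) < e.
  by rewrite -ball_normE /= -ltcR rnormE.
pose b n := 2 * (2^-1 ^+ n : R).
have b0 : b @ \oo --> (0 : R).
  rewrite -(mulr0 2); apply: cvgM; [exact: cvg_cst|apply: cvg_expr].
  by rewrite ger0_norm ?invr_ge0// invf_lt1// ltr1n.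
have xb n m : (n <= m)%N -> rnorm (x m - x n) <= b n.
  move=> nm; have [y [/ballE hn /ballE hm]] := filter_ex (filterI (hx n) (hx m)).
  rewrite -[x m](subrK y) -addrA; apply: (le_trans (rnormD _ _)).
  rewrite /b [in leRHS]mulr2n [in leRHS]mulrDl [in leRHS]mul1r.
  apply: lerD; last by rewrite rnormC; exact: ltW hn.
  apply: (le_trans (ltW hm)).
  by rewrite ler_wiXn2l// ?invr_ge0// invf_le1// ler1n.
have [l hl] := bop_seq_complete xb b0.
apply/cvg_ex; exists l; apply/cvg_ballP => e e0.
have er : e = (complex.Re e)%:C by rewrite RRe_real// gtr0_real.
have r0 : 0 < complex.Re e by rewrite -ltcR -er.
(* [x N] is within [b N] of the limit and within 2^-N of the points [y] of its
   ball; both are at most [b N] *)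
have [N _ hN] : \forall n \near \oo, 2 * b n < complex.Re e.
  by apply: (cvgr_lt 0) => //; rewrite -(mulr0 2); apply: cvgM => //; exact: cvg_cst.
near=> y; rewrite -ball_normE /= er -rnormE ltcR.
apply: le_lt_trans (hN N (leqnn _)).
rewrite -[l](subrK (x N)) -addrA (le_trans (rnormD _ _))// mulr2n mulrDl mul1r.
rewrite lerD//; have /ballE/ltW : ball (x N) ((2^-1 ^+ N : R)%:C) y by near: y; exact: hx.
by move/le_trans; apply; rewrite ler_peMl// ?ler1n// ltW.
Unshelve. all: by end_near. Qed.

HB.instance Definition _ := Uniform_isComplete.Build (bop W) bop_complete.

End BopComplete.

(** * The exponential and Cauchy products *)

Section Factorials.
Variable R : realType.
Implicit Types (r s : R).

Lemma natC n : (n%:R : R[i]) = (n%:R : R)%:C.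
Proof. by rewrite rmorph_nat. Qed.

Lemma invfactC n : ((n`!%:R : R[i])^-1) = ((n`!%:R : R)^-1)%:C.
Proof. by rewrite natC -fmorphV. Qed.

Lemma invfact_ge0 n : 0 <= (n`!%:R : R)^-1.
Proof. by rewrite invr_ge0. Qed.

Lemma invfactS n : (n.+1`!%:R : R)^-1 = n.+1%:R^-1 * n`!%:R^-1.
Proof. by rewrite factS natrM invfM. Qed.

Lemma invfactS_le n : (n.+1`!%:R : R)^-1 <= n`!%:R^-1.
Proof. by rewrite invfactS ler_piMl ?invfact_ge0// invf_le1// ler1n. Qed.

Lemma natr_invfactS n : n.+1%:R * (n.+1`!%:R : R)^-1 = n`!%:R^-1.
Proof. by rewrite invfactS mulrA mulfV ?mul1r// pnatr_eq0. Qed.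

Lemma exp_coeffS_le r n : 0 <= r -> exp_coeff r n.+1 <= r * exp_coeff r n.
Proof.
move=> r0; rewrite /exp_coeff /= exprS -mulrA ler_wpM2l// ler_wpM2l ?exprn_ge0//.
exact: invfactS_le.
Qed.

Lemma rsums_exp r : rsums (exp_coeff r) (expR r).
Proof. exact: is_cvg_series_exp_coeff. Qed.

Lemma rsumsZ c (b : nat -> R) t : rsums b t -> rsums (fun k => c * b k) (c * t).
Proof.
move=> h; rewrite /rsums.
have -> : series (fun k => c * b k) = (fun n => c * series b n).
  by apply/funext => n; rewrite /series /= mulr_sumr.
by apply: cvgM => //; exact: cvg_cst.
Qed.

Lemma exp_coeffD r s n :
  exp_coeff (r + s) n = \sum_(i < n.+1) exp_coeff r i * exp_coeff s (n - i)%N.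
Proof.
rewrite /exp_coeff /= addrC exprDn mulr_suml; apply: eq_bigr => i _.
have hi : (i <= n)%N by rewrite -ltnS.
have -> : (n`!%:R : R)^-1 = (i`!%:R^-1 * (n - i)`!%:R^-1) / 'C(n, i)%:R.
  rewrite -(bin_fact hi) !natrM !invfM.
  have b0 : ('C(n, i)%:R : R) != 0 by rewrite pnatr_eq0 -lt0n bin_gt0.
  by rewrite mulrC.
have b0 : ('C(n, i)%:R : R) != 0 by rewrite pnatr_eq0 -lt0n bin_gt0.
rewrite -mulr_natr; field.
by rewrite b0 !pnatr_eq0 -!lt0n !fact_gt0.
Qed.

End Factorials.
Arguments rsums_exp {R} r.

Lemma cauchy_prod_finite (K : pzRingType) (a b : nat -> K) N :
  \sum_(n < N) \sum_(i < n.+1) a i * b (n - i)%N =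
  \sum_(i < N) a i * \sum_(j < N - i) b j.
Proof.
elim: N => [|N IH]; first by rewrite !big_ord0.
rewrite big_ord_recr /= IH [RHS]big_ord_recr /= subSnn big_ord1.
rewrite [X in _ + X]big_ord_recr /= subnn addrA -big_split /=; congr (_ + _).
apply: eq_bigr => i _; rewrite subSn ?(ltnW (ltn_ord i))// big_ord_recr /= mulrDr //.
Qed.

Section CauchyProduct.
Variables (R : realType) (W : completeNormedModType R[i]).
Implicit Types (a b : nat -> bop W) (s t : bop W).

Lemma cvg_bopM a b s t : a @ \oo --> s -> b @ \oo --> t ->
  (fun n => a n * b n) @ \oo --> s * t.
Proof.
move=> /cvg_rnormP as_ /cvg_rnormP bt.
apply: (@cvg_rnorm_squeeze _ _ _ _ (fun n => rnorm (a n - s) * (rnorm (b n - t) + rnorm t)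
  + rnorm s * rnorm (b n - t))) => [n|].
  have -> : a n * b n - s * t = (a n - s) * b n + s * (b n - t).
    by rewrite mulrBl mulrBr addrA subrK.
  rewrite (le_trans (rnormD _ _))// lerD// (le_trans (rnormM _ _))//.
  rewrite ler_wpM2l ?rnorm_ge0// -{1}[b n](subrK t) rnormD//.
rewrite [X in _ --> X](_ : _ = 0 * (0 + rnorm t) + rnorm s * 0); last first.
  by rewrite mul0r mulr0 addr0.
apply: cvgD; apply: cvgM => //; first by apply: cvgD => //; exact: cvg_cst.
exact: cvg_cst.
Qed.

(** The difference between the product of the partial sums and the partial sum of
    the product is a sum of [a i * b j]; bounding it termwise by the same
    difference for the real exponential series reduces convergence to
    [expRD]. *)
Lemma sums_cauchy_prod a b s t (r r' : R) :
  (forall n, rnorm (a n) <= exp_coeff r n) ->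
  (forall n, rnorm (b n) <= exp_coeff r' n) ->
  sums a s -> sums b t ->
  sums (fun n => \sum_(i < n.+1) a i * b (n - i)%N) (s * t).
Proof.
move=> ar br sa tb.
have fin N : rnorm (series (fun n => \sum_(i < n.+1) a i * b (n - i)%N) N - series a N * series b N)
   <= series (exp_coeff r) N * series (exp_coeff r') N - series (exp_coeff (r + r')) N.
  rewrite rnormC !seriesEord /=.
  under [X in _ <= _ - X]eq_bigr do rewrite exp_coeffD.
  rewrite !cauchy_prod_finite !mulr_suml -!sumrB.
  rewrite (le_trans (rnorm_sum _ _))//; apply: ler_sum => i _.
  rewrite -!mulrBr (le_trans (rnormM _ _))// ler_pM ?rnorm_ge0//.
  by have := rnorm_series_le (leq_subr i N) br; rewrite !seriesEord.
have key : (fun N => series (fun n => \sum_(i < n.+1) a i * b (n - i)%N) N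
                     - series a N * series b N) @ \oo --> (0 : bop W).
  apply: cvg_rnorm_squeeze => [N|]; first by rewrite subr0; exact: fin.
  have -> : 0 = expR r * expR r' - expR (r + r') by rewrite expRD subrr.
  by apply: cvgB; [apply: cvgM|]; exact: rsums_exp.
have lim := cvgD key (cvg_bopM sa tb); rewrite add0r in lim.
rewrite /sums; set c := series _; suff -> : c = (c - (fun n => series a n * series b n)) +
    (fun n => series a n * series b n) by exact: lim.
by rewrite subrK.
Qed.

End CauchyProduct.

Lemma rnorm_invfact (R : realType) (E : normedModType R[i]) n (v : E) :
  rnorm ((n`!%:R : R[i])^-1 *: v) = n`!%:R^-1 * rnorm v.
Proof. by rewrite invfactC rnormZ ger0_norm ?invfact_ge0. Qed.

Section Exp.
Variables (R : realType) (W : completeNormedModType R[i]).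
Implicit Types x y z : bop W.

Definition exps x (n : nat) : bop W := (n`!%:R : R[i])^-1 *: x ^+ n.

Lemma rnorm_exps x n : rnorm (exps x n) <= exp_coeff (rnorm x) n.
Proof.
by rewrite rnorm_invfact mulrC ler_wpM2r ?invfact_ge0// rnormX.
Qed.

Lemma sums_exp x : sums (exps x) (op_exp x).
Proof.
have [s h _] := dominated_sums (rnorm_exps x) (rsums_exp _).
by rewrite /op_exp -/(exps x) (sums_lim h).
Qed.

Arguments sums_exp : clear implicits.

Lemma op_exp_eq x s : sums (exps x) s -> op_exp x = s.
Proof. by move=> h; apply: sums_unique (sums_exp x) h. Qed.

Lemma rnorm_exp x : rnorm (op_exp x) <= expR (rnorm x).
Proof. exact: sums_le (sums_exp x) (rsums_exp _) (rnorm_exps x). Qed.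

Lemma exps0 x : exps x 0 = 1.
Proof. by rewrite /exps expr0 fact0 invr1 scale1r. Qed.

Lemma exps1 x : exps x 1 = x.
Proof. by rewrite /exps expr1 invr1 scale1r. Qed.

Lemma rnorm_exp_sub1 x : rnorm (op_exp x - 1) <= rnorm x * expR (rnorm x).
Proof.
have bnd k : rnorm (exps x k.+1) <= rnorm x * exp_coeff (rnorm x) k.
  by rewrite (le_trans (rnorm_exps _ _))// exp_coeffS_le// rnorm_ge0.
have [s h hs] := dominated_sums bnd (rsumsZ (c := rnorm x) (rsums_exp _)).
by rewrite (op_exp_eq (sums_shift h)) exps0 addrC addKr.
Qed.

Lemma rnorm_exp_sub1x x : rnorm (op_exp x - 1 - x) <= rnorm x ^+ 2 * expR (rnorm x).
Proof.
have bnd k : rnorm (exps x k.+2) <= rnorm x ^+ 2 * exp_coeff (rnorm x) k.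
  rewrite (le_trans (rnorm_exps _ _))// (le_trans (exp_coeffS_le _ (rnorm_ge0 _)))//.
  by rewrite expr2 -mulrA ler_wpM2l ?rnorm_ge0// exp_coeffS_le// rnorm_ge0.
have [s h hs] := dominated_sums bnd (rsumsZ (c := rnorm x ^+ 2) (rsums_exp _)).
have h1 := sums_shift (a := fun k => exps x k.+1) h.
rewrite (op_exp_eq (sums_shift h1)) exps0 exps1.
by rewrite [X in rnorm (X - _)]addrC addKr [X in rnorm X]addrC addKr.
Qed.

Lemma op_exp0 : op_exp (0 : bop W) = 1.
Proof.
apply/eqP; rewrite -subr_eq0; apply/eqP/rnorm_le0.
by rewrite (le_trans (rnorm_exp_sub1 _))// rnorm0 mul0r.
Qed.

Lemma op_expD x y : x * y = y * x -> op_exp (x + y) = op_exp x * op_exp y.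
Proof.
move=> xy; apply: op_exp_eq.
apply: sums_ext (sums_cauchy_prod (rnorm_exps x) (rnorm_exps y) (sums_exp x) (sums_exp y)).
move=> n; rewrite /exps addrC exprDn_comm// scaler_sumr; apply: eq_bigr => i _.
have hi : (i <= n)%N by rewrite -ltnS.
have -> : y ^+ (n - i) * x ^+ i = x ^+ i * y ^+ (n - i).
  by apply: commrX; apply/commr_sym/commrX.
rewrite -bop_scalerAl -bop_scalerAr scalerA.
rewrite -[X in _ = _ *: X]scaler_nat scalerA; congr (_ *: _).
rewrite -(bin_fact hi) !natrM !invfM.
have b0 : ('C(n, i)%:R : R[i]) != 0 by rewrite pnatr_eq0 -lt0n bin_gt0.
field; by rewrite b0 !pnatr_eq0 -!lt0n !fact_gt0.
Qed.

Lemma op_expVl x : op_exp (- x) * op_exp x = 1.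
Proof. by rewrite -op_expD ?addNr ?op_exp0// mulrN mulNr. Qed.

Lemma op_expVr x : op_exp x * op_exp (- x) = 1.
Proof. by rewrite -op_expD ?subrr ?op_exp0// mulrN mulNr. Qed.

End Exp.
Arguments sums_exp {R W} x.

(** * The derivative of the exponential *)

Section DividedDifferences.
Variable K : pzRingType.
Implicit Types (a b p t : K).

(** For commuting [a] and [b] this is the divided difference
    (a^n - b^n) / (a - b), the sum of the a^i b^j with i + j = n - 1. *)
Fixpoint divdiff a b n : K :=
  if n is m.+1 then a * divdiff a b m + b ^+ m else 0.

(** For commuting [p] and [t] this is ((p + t)^n - p^n) / t, expanded by the
    binomial formula. *)
Definition bindiff p t n : K :=
  \sum_(i < n) (p ^+ i * t ^+ (n.-1 - i)) *+ 'C(n, i).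

Lemma bindiffE p t n : p * t = t * p ->
  (p + t) ^+ n = p ^+ n + t * bindiff p t n.
Proof.
move=> pt; rewrite addrC (exprDn_comm _ (commr_sym pt)) big_ord_recr/= subnn expr0 mul1r binn.
rewrite mulr1n addrC; congr (_ + _); rewrite mulr_sumr; apply: eq_bigr => i _.
rewrite mulrnAr mulrA (commrX i (commr_sym pt)) -mulrA -exprS.
have -> : (n.-1 - i).+1 = (n - i)%N.
  by case: n i => [[]|n] //= i; rewrite subSn// -ltnS.
by rewrite (commrX _ (commr_sym (commrX i (commr_sym pt)))).
Qed.

Lemma bindiffS p t n : p * t = t * p ->
  bindiff p t n.+1 = (p + t) * bindiff p t n + p ^+ n.
Proof.
move=> pt; rewrite mulrDl -addrA [_ + p ^+ n]addrC -bindiffE// {1}/bindiff.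
rewrite big_ord_recl /= subn0 expr0 mul1r bin0 mulr1n.
under eq_bigr do rewrite binS mulrnDr.
rewrite big_split /= addrA addrC; congr (_ + _).
  rewrite /bindiff mulr_sumr; apply: eq_bigr => i _.
  rewrite /bump leq0n add1n mulrnAr mulrA -exprS; congr ((_ * _ ^+ _) *+ _).
  by rewrite /= -[n.-1]subn1 -subnDA add1n.
rewrite [p + t]addrC (exprDn_comm _ (commr_sym pt)) big_ord_recl subn0 expr0 mulr1 bin0 mulr1n; congr (_ + _).
apply: eq_bigr => i _; congr (_ *+ _).
by rewrite (commrX _ (commr_sym (commrX _ (commr_sym pt)))).
Qed.

(** Split (p + t)^n - (p - t)^n at p^n and divide by t. As t may be a zero
    divisor, the proof is by induction on n. *)
Lemma divdiff_bindiff p t n : p * t = t * p ->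
  divdiff (p + t) (p - t) n *+ 2 = bindiff p t n + bindiff p (- t) n.
Proof.
move=> pt; have ptN : p * (- t) = (- t) * p by rewrite mulrN mulNr pt.
elim: n => [|n IH] /=; first by rewrite /bindiff !big_ord0 mul0rn addr0.
rewrite !bindiffS// mulrnDl -mulrnAr IH (bindiffE _ ptN) mulrDr mulr2n.
rewrite -!addrA; congr (_ + _); rewrite mulrDl mulrBl mulNr.
set u := p * _; set v := t * _; set w := p ^+ n.
by rewrite [w + (- v + _)]addrA addrACA subrKC [u - v + w]addrC addrCA addrC.
Qed.

End DividedDifferences.

Section SumsMap.
Variables (R : realType) (E F : completeNormedModType R[i]).

Lemma cvg_lipschitz (g : E -> F) (c : R) (u : nat -> E) (l : E) :
  (forall x y, rnorm (g x - g y) <= c * rnorm (x - y)) ->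
  u @ \oo --> l -> g \o u @ \oo --> g l.
Proof.
move=> gc /cvg_rnormP ul.
apply: (@cvg_rnorm_squeeze _ _ _ _ (fun n => c * rnorm (u n - l))) => [n|]; first exact: gc.
by rewrite -(mulr0 c); apply: cvgM => //; exact: cvg_cst.
Qed.

Lemma sums_map (g : E -> F) (c : R) (a : nat -> E) (s : E) :
  {morph g : x y / x + y} -> (forall x, rnorm (g x) <= c * rnorm x) ->
  sums a s -> sums (g \o a) (g s).
Proof.
move=> gD gc as_.
have g0 : g 0 = 0 by apply: (addrI (g 0)); rewrite -gD !addr0.
have gB x y : g x - g y = g (x - y) by apply/eqP; rewrite subr_eq -gD subrK.
rewrite /sums.
have -> : series (g \o a) = g \o series a.
  apply/funext => n; rewrite /series /=.
  by elim/big_ind2 : _ => // x x' y y' -> ->; rewrite gD.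
by apply: (@cvg_lipschitz _ c) => // x y; rewrite gB.
Qed.

End SumsMap.

Section LeftRight.
Variables (R : realType) (V : completeNormedModType R[i]).
Implicit Types (a b x y k w : bop V).

Fact lmul_subproof a : bounded_linear_op (fun x : bop V => a * x).
Proof.
apply/asboolP; split; first by move=> c u v; rewrite mulrDr bop_scalerAr.
by exists (rnorm a) => v; rewrite -!rnormE -rmorphM lecR rnormM.
Qed.
Definition lmul a : bop (bop V) := Bop (lmul_subproof a).

Fact rmul_subproof a : bounded_linear_op (fun x : bop V => x * a).
Proof.
apply/asboolP; split; first by move=> c u v; rewrite mulrDl bop_scalerAl.
by exists (rnorm a) => v; rewrite -!rnormE -rmorphM lecR mulrC rnormM.
Qed.
Definition rmul a : bop (bop V) := Bop (rmul_subproof a).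

Lemma lmulD : {morph lmul : a b / a + b}.
Proof. by move=> a b; apply/bopP => x; exact: mulrDl. Qed.

Lemma rmulD : {morph rmul : a b / a + b}.
Proof. by move=> a b; apply/bopP => x; exact: mulrDr. Qed.

Lemma rnorm_lmul a : rnorm (lmul a) <= rnorm a.
Proof. by apply: rnorm_bop_le; rewrite ?rnorm_ge0// => x; exact: rnormM. Qed.

Lemma rnorm_rmul a : rnorm (rmul a) <= rnorm a.
Proof.
by apply: rnorm_bop_le; rewrite ?rnorm_ge0// => x; rewrite mulrC; exact: rnormM.
Qed.

Lemma lmulN a : lmul (- a) = - lmul a.
Proof. by apply/bopP => x; exact: mulNr. Qed.

Lemma rmulN a : rmul (- a) = - rmul a.
Proof. by apply/bopP => x; exact: mulrN. Qed.

Lemma lmul_rmul a b : lmul a * rmul b = rmul b * lmul a.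
Proof. by apply/bopP => x; exact: mulrA. Qed.

Lemma lmulX a n : lmul a ^+ n = lmul (a ^+ n).
Proof.
elim: n => [|n IH]; first by apply/bopP => x; rewrite /= mul1r.
by rewrite !exprS IH; apply/bopP => x; rewrite /= mulrA.
Qed.

Lemma rmulX a n : rmul a ^+ n = rmul (a ^+ n).
Proof.
elim: n => [|n IH]; first by apply/bopP => x; rewrite /= mulr1.
by rewrite exprSr IH; apply/bopP => x; rewrite /= -mulrA exprS.
Qed.

Lemma op_exp_lmul a : op_exp (lmul a) = lmul (op_exp a).
Proof.
apply: op_exp_eq.
have := sums_map (c := 1) lmulD; rewrite -/(bop (bop V)) => h.
apply: sums_ext (h _ _ _ (sums_exp a)) => [n|x]; last by rewrite mul1r rnorm_lmul.
by rewrite /exps lmulX /=; apply/bopP => x; rewrite /= -bop_scalerAl.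
Qed.

Lemma op_exp_rmul a : op_exp (rmul a) = rmul (op_exp a).
Proof.
apply: op_exp_eq.
have h := sums_map (c := 1) rmulD.
apply: sums_ext (h _ _ _ (sums_exp a)) => [n|x]; last by rewrite mul1r rnorm_rmul.
by rewrite /exps rmulX /=; apply/bopP => x; rewrite /= -bop_scalerAr.
Qed.

Definition ad k : bop (bop V) := lmul k - rmul k.

(** [lmul k] and [rmul k] commute, so their sum and difference exponentiate to
    products of a left and a right multiplication. *)
Lemma op_exp_ad k x : op_exp (ad k) x = op_exp k * x * op_exp (- k).
Proof.
rewrite /ad op_expD; last by rewrite mulrN mulNr lmul_rmul.
by rewrite -rmulN op_exp_lmul op_exp_rmul /= mulrA.
Qed.

Lemma op_exp_anti k x : op_exp (lmul k + rmul k) x = op_exp k * x * op_exp k.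
Proof.
rewrite op_expD; last by rewrite lmul_rmul.
by rewrite op_exp_lmul op_exp_rmul /= mulrA.
Qed.

Lemma rnorm_ad k : rnorm (ad k) <= 2 * rnorm k.
Proof.
by rewrite (le_trans (rnormB _ _))// mulr2n mulrDl mul1r lerD ?rnorm_lmul ?rnorm_rmul.
Qed.

End LeftRight.

Section Phi.
Variables (R : realType) (W : completeNormedModType R[i]).
Implicit Types p t : bop W.

Lemma scaler_half_double (E : lmodType R[i]) (x : E) : (2^-1 : R)%:C *: (x *+ 2) = x.
Proof.
rewrite -[X in _ *: X]scaler_nat scalerA natC -rmorphM.
by rewrite mulVf ?pnatr_eq0// scale1r.
Qed.

Lemma half_split (E : lmodType R[i]) (x : E) :
  x = (2^-1 : R)%:C *: x + (2^-1 : R)%:C *: x.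
Proof. by rewrite -scalerDr -mulr2n scaler_half_double. Qed.

(** The power series (e^t - 1) / t, which has a value even when [t] is not
    invertible. *)
Definition phis t n : bop W := (n.+1`!%:R : R[i])^-1 *: t ^+ n.

Lemma rnorm_phis t n : rnorm (phis t n) <= exp_coeff (rnorm t) n.
Proof.
rewrite rnorm_invfact mulrC ler_pM ?rnorm_ge0 ?invfact_ge0 ?invfactS_le//.
exact: rnormX.
Qed.

Definition phi t : bop W := limn (series (phis t)).

Lemma sums_phi t : sums (phis t) (phi t).
Proof.
have [s h _] := dominated_sums (rnorm_phis t) (rsums_exp _).
by rewrite /phi (sums_lim h).
Qed.

Arguments sums_phi : clear implicits.

Lemma exps_phis p t n :
  \sum_(i < n.+1) exps p i * phis t (n - i)%N =
  (n.+1`!%:R : R[i])^-1 *: bindiff p t n.+1.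
Proof.
rewrite /bindiff scaler_sumr; apply: eq_bigr => i _ /=.
have hi : (i <= n)%N by rewrite -ltnS.
rewrite -bop_scalerAl -bop_scalerAr scalerA.
rewrite -[X in _ = _ *: X]scaler_nat scalerA; congr (_ *: _).
rewrite -(@bin_fact n.+1 i) ?(leqW hi)// subSn// !natrM !invfM.
have b0 : ('C(n.+1, i)%:R : R[i]) != 0 by rewrite pnatr_eq0 -lt0n bin_gt0 leqW.
by rewrite [RHS]mulrC mulVKf.
Qed.

(** Formally (e^(p + t) - e^p) / t = e^p (e^t - 1) / t. *)
Lemma sums_bindiff p t :
  sums (fun n => (n`!%:R : R[i])^-1 *: bindiff p t n) (op_exp p * phi t).
Proof.
rewrite -[op_exp p * _]add0r.
have -> : 0 = (fun n => (n`!%:R : R[i])^-1 *: bindiff p t n) 0%N.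
  by rewrite /bindiff big_ord0 scaler0.
apply: sums_shift.
have h := sums_cauchy_prod (rnorm_exps p) (rnorm_phis t) (sums_exp p) (sums_phi t).
by apply: sums_ext h => n; exact: exps_phis.
Qed.

Arguments sums_bindiff : clear implicits.

(** With a = p + t and b = p - t, formally
    (e^a - e^b) / (a - b) = e^p sinh t / t, and sinh t / t is the even part of
    (e^t - 1) / t. *)
Lemma sums_divdiff p t : p * t = t * p ->
  sums (fun n => (n`!%:R : R[i])^-1 *: divdiff (p + t) (p - t) n)
    (op_exp p * ((2^-1 : R)%:C *: (phi t + phi (- t)))).
Proof.
move=> pt; rewrite -bop_scalerAr mulrDr.
have h := sumsZ (c := (2^-1)%:C) (sumsD (sums_bindiff p t) (sums_bindiff p (- t))).
apply: sums_ext h => n /=.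
by rewrite -scalerDr -divdiff_bindiff// scalerA mulrC -scalerA scaler_half_double.
Qed.

End Phi.
Arguments sums_phi {R W} t.
Arguments sums_bindiff {R W} p t.
Arguments sums_divdiff {R W} p t _.

Section Apply.
Variables (R : realType) (W : completeNormedModType R[i]).

Lemma bop_scaleE (c : R[i]) (f : bop W) (v : W) : (c *: f) v = c *: f v.
Proof. by []. Qed.

Lemma bop_mulE (f g : bop W) (v : W) : (f * g) v = f (g v).
Proof. by []. Qed.

Lemma bop_addE (f g : bop W) (v : W) : (f + g) v = f v + g v.
Proof. by []. Qed.

Lemma bop_subE (f g : bop W) (v : W) : (f - g) v = f v - g v.
Proof. by []. Qed.

Lemma sums_apply (a : nat -> bop W) (s : bop W) (v : W) :
  sums a s -> sums (fun n => a n v) (s v).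
Proof.
move=> h; apply: (sums_map (g := fun f : bop W => f v) (c := rnorm v) _ _ h) => // f.
by rewrite mulrC; exact: rnorm_apply.
Qed.

End Apply.
Arguments sums_apply {R W a s} v _.

Section Taylor.
Variables (R : realType) (V : completeNormedModType R[i]).
Implicit Types (a b x y h k w : bop V) (r : R).

(** The operator sinh (ad k) / ad k, as the even part of (e^t - 1) / t. *)
Definition sinhc k : bop (bop V) :=
  (2^-1 : R)%:C *: (phi (ad k) + phi (- ad k)).

(** The derivative at 2k of the n-th power map, in the direction w, is
    [divdiff (lmul (k + k)) (rmul (k + k)) n w]; the identity is [sums_divdiff]
    for p = lmul k + rmul k and t = ad k. *)
Lemma sums_dexp k w :
  sums (fun n => (n`!%:R : R[i])^-1 *: divdiff (lmul (k + k)) (rmul (k + k)) n w)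
    (op_exp k * sinhc k w * op_exp k).
Proof.
have PT : (lmul k + rmul k) * ad k = ad k * (lmul k + rmul k).
  by rewrite /ad mulrBl mulrDl mulrBr !mulrDr !lmul_rmul mulrN subrKA addrKA.
have := sums_divdiff _ _ PT; rewrite -/(sinhc k).
have -> : lmul k + rmul k + ad k = lmul (k + k).
  by rewrite /ad lmulD addrACA subrr addr0.
have -> : lmul k + rmul k - ad k = rmul (k + k).
  by rewrite /ad rmulD opprB addrC addrA subrK.
move=> h.
rewrite -op_exp_anti.
have {}h := sums_apply w h; rewrite bop_mulE in h.
by apply: sums_ext h => n; rewrite bop_scaleE.
Qed.
Arguments sums_dexp : clear implicits.

Definition taylor_rem h w n : bop V :=
  (h + w) ^+ n - h ^+ n - divdiff (lmul h) (rmul h) n w.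

Lemma divdiffS_apply h w n : divdiff (lmul h) (rmul h) n.+1 w =
  h * divdiff (lmul h) (rmul h) n w + w * h ^+ n.
Proof. by rewrite [divdiff _ _ _.+1]/= rmulX bop_addE bop_mulE. Qed.

Lemma divdiff0_apply h w : divdiff (lmul h) (rmul h) 0 w = 0.
Proof. by []. Qed.

Lemma taylor_remS h w n : taylor_rem h w n.+1 =
  (h + w) * taylor_rem h w n + w * divdiff (lmul h) (rmul h) n w.
Proof.
rewrite /taylor_rem divdiffS_apply !exprS.
set d := bop_fun (divdiff _ _ _) w.
rewrite !mulrBr (mulrDl h w d) (mulrDl h w (h ^+ n)) !opprD -!addrA addNr addr0.
by congr (_ + (_ + _)); rewrite addrC.
Qed.

Lemma taylor_rem0 h w : taylor_rem h w 0 = 0.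
Proof. by rewrite /taylor_rem divdiff0_apply !expr0 subrr subr0. Qed.

Lemma taylor_rem1 h w : taylor_rem h w 1 = 0.
Proof. by rewrite taylor_remS divdiff0_apply taylor_rem0 !mulr0 addr0. Qed.

Lemma rnorm_divdiff h w n r : rnorm h <= r ->
  rnorm (divdiff (lmul h) (rmul h) n.+1 w) <= n.+1%:R * r ^+ n * rnorm w.
Proof.
move=> hr; have r0 : 0 <= r by rewrite (le_trans (rnorm_ge0 h)).
elim: n => [|n IH].
  by rewrite divdiffS_apply divdiff0_apply mulr0 add0r !expr0 mulr1 !mul1r.
rewrite divdiffS_apply -natr1 2!mulrDl mul1r (le_trans (rnormD _ _))// lerD//.
  rewrite exprS (le_trans (rnormM _ _))//.
  have -> : n.+1%:R * (r * r ^+ n) * rnorm w = r * (n.+1%:R * r ^+ n * rnorm w) by ring.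
  by rewrite ler_pM ?rnorm_ge0.
rewrite (le_trans (rnormM _ _))// mulrC ler_wpM2r ?rnorm_ge0//.
by rewrite (le_trans (rnormX _ _))// lerXn2r ?nnegrE ?rnorm_ge0.
Qed.

Lemma rnorm_taylor_rem h w n r : rnorm h + rnorm w <= r ->
  rnorm (taylor_rem h w n.+2) <= n.+2%:R * n.+1%:R * r ^+ n * rnorm w ^+ 2.
Proof.
move=> hr; have hr' : rnorm h <= r by rewrite (le_trans _ hr)// lerDl rnorm_ge0.
have r0 : 0 <= r by rewrite (le_trans (rnorm_ge0 h)).
have hw : rnorm (h + w) <= r by rewrite (le_trans (rnormD _ _)).
have step m : rnorm (w * divdiff (lmul h) (rmul h) m.+1 w)
    <= m.+1%:R * r ^+ m * rnorm w ^+ 2.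
  rewrite (le_trans (rnormM _ _))// expr2 mulrC mulrA ler_wpM2r ?rnorm_ge0//.
  exact: rnorm_divdiff.
elim: n => [|n IH].
  rewrite taylor_remS taylor_rem1 mulr0 add0r (le_trans (step _))//.
  by rewrite !expr0 !mulr1 mul1r ler_peMl ?sqr_ge0 ?ler1n.
rewrite taylor_remS (le_trans (rnormD _ _))//.
have -> : n.+3%:R * n.+2%:R * r ^+ n.+1 * rnorm w ^+ 2 =
  r * (n.+2%:R * n.+1%:R * r ^+ n * rnorm w ^+ 2) + (n.+2%:R * r ^+ n.+1 * rnorm w ^+ 2)
  + n.+2%:R * r ^+ n.+1 * rnorm w ^+ 2.
  by rewrite exprS -[n.+3%:R]natr1 -[n.+2%:R]natr1 -[n.+1%:R]natr1; ring.
rewrite -[leLHS]addr0 lerD ?lerD ?step//; last by rewrite !mulr_ge0 ?exprn_ge0 ?rnorm_ge0.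
by rewrite (le_trans (rnormM _ _))// ler_pM ?rnorm_ge0.
Qed.

(** The remainder is estimated degree by degree: [taylor_rem] obeys a recursion
    whose real majorant, divided by the factorials, sums to |w|^2 e^r. *)
Lemma op_exp_taylor k w r : rnorm (k + k) + rnorm w <= r ->
  rnorm (op_exp (k + k + w) - op_exp (k + k) - op_exp k * sinhc k w * op_exp k)
   <= rnorm w ^+ 2 * expR r.
Proof.
move=> hr.
have h := sumsB (sumsB (sums_exp (k + k + w)) (sums_exp (k + k))) (sums_dexp k w).
pose b n := if n is m.+2 then rnorm w ^+ 2 * exp_coeff r m else 0.
have bs : rsums b (b 0%N + (b 1%N + rnorm w ^+ 2 * expR r)).
  apply: rsums_shift; apply: (rsums_shift (b := fun n => b n.+1)).
  exact: rsumsZ (rsums_exp r).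
rewrite /= !add0r in bs.
apply: (sums_le h bs) => n.
have -> : exps (k + k + w) n - exps (k + k) n -
   (n`!%:R : R[i])^-1 *: divdiff (lmul (k + k)) (rmul (k + k)) n w =
   (n`!%:R : R[i])^-1 *: taylor_rem (k + k) w n by rewrite /taylor_rem !scalerBr.
rewrite rnorm_invfact; case: n => [|[|n]] /=.
- by rewrite taylor_rem0 rnorm0 mulr0.
- by rewrite taylor_rem1 rnorm0 mulr0.
rewrite (le_trans (ler_wpM2l (invfact_ge0 _ _) (rnorm_taylor_rem n hr)))//.
rewrite /exp_coeff /= -(natr_invfactS _ n) -(natr_invfactS _ n.+1).
by rewrite le_eqVlt; apply/orP; left; apply/eqP; ring.
Qed.

End Taylor.

Section ExpLip.
Variables (R : realType) (W : completeNormedModType R[i]).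
Implicit Types x y t : bop W.

Lemma rnorm_subX x y n (r : R) : rnorm x <= r -> rnorm y <= r ->
  rnorm (x ^+ n.+1 - y ^+ n.+1) <= n.+1%:R * r ^+ n * rnorm (x - y).
Proof.
move=> xr yr; have r0 : 0 <= r by rewrite (le_trans (rnorm_ge0 x)).
elim: n => [|n IH]; first by rewrite !expr1 expr0 !mul1r.
have -> : x ^+ n.+2 - y ^+ n.+2 = x * (x ^+ n.+1 - y ^+ n.+1) + (x - y) * y ^+ n.+1.
  by rewrite mulrBr mulrBl -!exprS addrA subrK.
rewrite -natr1 2![in leRHS]mulrDl [in leRHS]mul1r (le_trans (rnormD _ _))// lerD//.
  rewrite (le_trans (rnormM _ _))//.
  have -> : n.+1%:R * r ^+ n.+1 * rnorm (x - y) = r * (n.+1%:R * r ^+ n * rnorm (x - y)).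
    by rewrite exprS; ring.
  by rewrite ler_pM ?rnorm_ge0.
rewrite (le_trans (rnormM _ _))// mulrC ler_wpM2r ?rnorm_ge0//.
by rewrite (le_trans (rnormX _ _))// lerXn2r ?nnegrE ?rnorm_ge0.
Qed.

Lemma rnorm_exp_sub x y (r : R) : rnorm x <= r -> rnorm y <= r ->
  rnorm (op_exp x - op_exp y) <= expR r * rnorm (x - y).
Proof.
move=> xr yr; have h := sumsB (sums_exp x) (sums_exp y).
pose b n := if n is m.+1 then rnorm (x - y) * exp_coeff r m else 0.
have bs : rsums b (b 0%N + rnorm (x - y) * expR r).
  by apply: rsums_shift; exact: rsumsZ (rsums_exp r).
rewrite /= add0r mulrC in bs.
apply: (sums_le h bs) => n.
rewrite /exps -scalerBr rnorm_invfact; case: n => [|n] /=.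
  by rewrite !expr0 subrr rnorm0 mulr0.
rewrite (le_trans (ler_wpM2l (invfact_ge0 _ _) (rnorm_subX n xr yr)))//.
rewrite /exp_coeff /= -(natr_invfactS _ n).
by rewrite le_eqVlt; apply/orP; left; apply/eqP; ring.
Qed.

Lemma subrX_le (s t : R) n : 0 <= s <= 1 -> 0 <= t <= 1 ->
  `|s ^+ n - t ^+ n| <= n%:R * `|s - t|.
Proof.
move=> /andP[s0 s1] /andP[t0 t1]; elim: n => [|n IH].
  by rewrite !expr0 subrr normr0 mul0r.
have -> : s ^+ n.+1 - t ^+ n.+1 = s * (s ^+ n - t ^+ n) + (s - t) * t ^+ n.
  by rewrite !exprS; ring.
rewrite -natr1 [in leRHS]mulrDl mul1r (le_trans (ler_normD _ _))// lerD//.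
  by rewrite normrM ger0_norm// (le_trans _ IH)// ler_piMl.
by rewrite normrM ler_piMr// ger0_norm ?exprn_ge0// exprn_ile1.
Qed.

Lemma rnorm_phi_lip t (s s' : R) : 0 <= s <= 1 -> 0 <= s' <= 1 ->
  rnorm (phi (s%:C *: t) - phi (s'%:C *: t)) <= `|s - s'| * expR (rnorm t).
Proof.
move=> hs hs'; have h := sumsB (sums_phi (s%:C *: t)) (sums_phi (s'%:C *: t)).
apply: (sums_le h (rsumsZ (c := `|s - s'|) (rsums_exp (rnorm t)))) => n.
rewrite /phis !bop_exprZn -scalerBr -scalerBl -!rmorphXn -rmorphB rnorm_invfact rnormZ.
rewrite /exp_coeff /= -(natr_invfactS _ n).
have -> : `|s - s'| * (rnorm t ^+ n * (n.+1%:R * n.+1`!%:R^-1)) =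
  n.+1%:R * `|s - s'| * (n.+1`!%:R^-1 * rnorm t ^+ n) by ring.
rewrite mulrCA ler_pM ?mulr_ge0 ?rnorm_ge0 ?invfact_ge0//.
  by rewrite (le_trans (subrX_le n hs hs'))// ler_wpM2r// ler_nat.
by rewrite ler_wpM2l ?invfact_ge0// rnormX.
Qed.

Lemma phi0 : phi (0 : bop W) = 1.
Proof.
have z : sums (fun n => phis (0 : bop W) n.+1) 0.
  apply: (@cvg_rnorm_squeeze _ _ _ _ (fun=> 0)); last exact: cvg_cst.
  move=> n; rewrite subr0 /series /= big1 ?rnorm0// => i _.
  by rewrite /phis exprS mul0r scaler0.
rewrite (sums_unique (sums_phi 0) (sums_shift z)) addr0.
by rewrite /phis expr0 invr1 scale1r.
Qed.

Lemma rnorm_phi_taylor t :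
  rnorm (phi t - 1 - (2^-1)%:C *: t - (6^-1)%:C *: t ^+ 2) <= rnorm t ^+ 3 * expR (rnorm t).
Proof.
have bnd n : rnorm (phis t n.+3) <= rnorm t ^+ 3 * exp_coeff (rnorm t) n.
  rewrite (le_trans (rnorm_phis _ _))//.
  have r0 := rnorm_ge0 t.
  rewrite (le_trans (exp_coeffS_le _ r0))// exprS -mulrA ler_wpM2l//.
  rewrite (le_trans (exp_coeffS_le _ r0))// expr2 -mulrA ler_wpM2l//.
  exact: exp_coeffS_le.
have [s h hs] := dominated_sums bnd (rsumsZ (c := rnorm t ^+ 3) (rsums_exp _)).
have h2 := sums_shift (a := fun n => phis t n.+2) h.
have h1 := sums_shift (a := fun n => phis t n.+1) h2.
rewrite (sums_unique (sums_phi t) (sums_shift h1)).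
have -> : phis t 0 = 1 by rewrite /phis expr0 invr1 scale1r.
have -> : phis t 1 = (2^-1)%:C *: t by rewrite /phis expr1 invfactC.
have -> : phis t 2 = (6^-1)%:C *: t ^+ 2 by rewrite /phis invfactC.
by rewrite -addrA -opprD -addrA -opprD !addrA addrC addrA addNr add0r.
Qed.

End ExpLip.

(** * Selfadjoint operators and the Lipschitz bound for log *)

Section Reals.
Variable R : realType.
Implicit Types a b K d s : R.

Lemma le_add_small a b K d : 0 < d ->
  (forall s, 0 < s -> s <= d -> a <= b + s * K) -> a <= b.
Proof.
move=> d0 h; apply/ler_addgt0Pr => e e0.
pose s := Num.min d (e / (`|K| + 1)).
have K1 : 0 < `|K| + 1 by rewrite ltr_pwDr.
have s0 : 0 < s by rewrite lt_min d0 divr_gt0.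
have sd : s <= d by rewrite ge_min lexx.
rewrite (le_trans (h s s0 sd))// lerD2l.
rewrite (le_trans (ler_wpM2l (ltW s0) (ler_norm K)))//.
have : s <= e / (`|K| + 1) by rewrite ge_min lexx orbT.
rewrite ler_pdivlMr// => /(le_trans _); apply.
by rewrite ler_wpM2l ?(ltW s0)// lerDl.
Qed.

Lemma cvg_half : (fun n => 2^-1 ^+ n : R) @ \oo --> (0 : R).
Proof. by apply: cvg_expr; rewrite ger0_norm ?invr_ge0// invf_lt1// ltr1n. Qed.

Lemma le_add_cvg0 a b (u : nat -> R) : u @ \oo --> (0 : R) ->
  (forall n, a <= b + u n) -> a <= b.
Proof.
move=> u0 h; rewrite -[b]addr0.
have bu : (fun n => b + u n) @ \oo --> b + 0 by apply: cvgD => //; exact: cvg_cst.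
by apply: (cvgr_to_ge bu); exact: nearW.
Qed.

End Reals.

Lemma sandwich1B (K : pzRingType) (a x : K) :
  (1 - a) * x * (1 - a) = x - (a * x + x * a) + a * x * a.
Proof. by rewrite mulrBl mul1r mulrBr mulr1 mulrBl opprB opprD addrA -!addrA; congr (_ + (_ + _)); rewrite addrC. Qed.

Lemma jordan_sub_sqr (K : pzRingType) (a b : K) :
  (a + b) * (a - b) + (a - b) * (a + b) = (a * a - b * b) *+ 2.
Proof.
rewrite mulrDl !mulrBr mulrBl !mulrDr opprD addrACA [X in X + _]addrACA addNr.
by rewrite [X in _ + X]addrACA subrr addr0 add0r mulr2n [RHS]addrACA.
Qed.

Section Hilbert.
Variables (R : realType) (V : completeNormedModType R[i]).
Variable dot : {dot V for @Num.conj R[i]}.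
Hypothesis hV : hilbert_norm dot.
Implicit Types (u v : V) (x y h k a p : bop V) (s t c m : R).

(** The real part of the inner product, a symmetric real bilinear form; it
    determines adjoints ([adjointP]). *)
Definition rdot u v : R := complex.Re (dot u v).

Lemma rdotvv v : rdot v v = rnorm v ^+ 2.
Proof. by rewrite /rdot -hV -rnormE -rmorphXn. Qed.

Lemma rdotC u v : rdot u v = rdot v u.
Proof.
have ReJ (z : R[i]) : complex.Re (conjc z) = complex.Re z by case: z.
by rewrite /rdot hermC expr0 mul1r; exact: ReJ.
Qed.

Lemma rdotDl u u' v : rdot (u + u') v = rdot u v + rdot u' v.
Proof. by rewrite /rdot linearDl raddfD. Qed.

Lemma rdotZl t u v : rdot (t%:C *: u) v = t * rdot u v.
Proof. by rewrite /rdot linearZl_LR /=; case: (dot u v) => a b /=; rewrite mul0r subr0. Qed.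

Lemma rdotNl u v : rdot (- u) v = - rdot u v.
Proof. by rewrite /rdot linearNl raddfN. Qed.

Lemma rdotDr u v v' : rdot u (v + v') = rdot u v + rdot u v'.
Proof. by rewrite rdotC rdotDl !(rdotC u). Qed.

Lemma rdotNr u v : rdot u (- v) = - rdot u v.
Proof. by rewrite rdotC rdotNl rdotC. Qed.

Lemma rdotZr t u v : rdot u (t%:C *: v) = t * rdot u v.
Proof. by rewrite rdotC rdotZl rdotC. Qed.

Lemma rnormBsqr u v :
  rnorm (u - v) ^+ 2 = rnorm u ^+ 2 - 2 * rdot u v + rnorm v ^+ 2.
Proof.
rewrite -!rdotvv rdotDl !rdotDr !rdotNl !rdotNr (rdotC v u); ring.
Qed.

Lemma rdot_le u v : rdot u v <= rnorm u * rnorm v.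
Proof.
have [/eqP u0|u0] := boolP (rnorm u == 0).
  by rewrite (rnorm_le0 (v := u)) ?u0// rnorm0 mul0r /rdot linear0l.
have [/eqP v0|v0] := boolP (rnorm v == 0).
  by rewrite (rnorm_le0 (v := v)) ?v0// rnorm0 mulr0 /rdot linear0r.
have := sqr_ge0 (rnorm ((rnorm v)%:C *: u - (rnorm u)%:C *: v)).
rewrite rnormBsqr rdotZl rdotZr !rnormZ !ger0_norm ?rnorm_ge0//.
have uv0 : 0 < rnorm u * rnorm v by rewrite mulr_gt0// lt_def ?u0 ?v0 rnorm_ge0.
move: (rnorm u) (rnorm v) (rdot u v) uv0 => a b d ab h.
have : 0 <= (a * b) * (2 * (a * b - d)).
  by move: h; congr (_ <= _); ring.
by rewrite pmulr_rge0// pmulr_rge0// subr_ge0.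
Qed.

Lemma rdot_abs u v : `|rdot u v| <= rnorm u * rnorm v.
Proof.
by rewrite ler_norml rdot_le andbT lerNl -rdotNl -(rnormN u) rdot_le.
Qed.

Lemma adjointP x y :
  adjoint dot x y <-> forall u v, rdot (x u) v = rdot u (y v).
Proof.
split=> [h u v|h u v]; first by rewrite /rdot h.
apply/eqP; rewrite eq_complex; apply/andP; split; apply/eqP; first exact: h.
have imE u' v' : complex.Im (dot u' v') = - rdot ('i *: u') v'.
  rewrite /rdot linearZl_LR /=; case: (dot u' v') => a b /=.
  by rewrite mul0r mul1r sub0r opprK.
by rewrite !imE -h linearZ.
Qed.

Definition sadj x : Prop := adjoint dot x x.

Lemma sadjP x : sadj x <-> forall u v, rdot (x u) v = rdot u (x v).
Proof. exact: adjointP. Qed.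

Lemma sadj0 : sadj 0.
Proof. by move=> u v; rewrite linear0l linear0r. Qed.

Lemma sadj1 : sadj 1. Proof. by []. Qed.

Lemma sadjD x y : sadj x -> sadj y -> sadj (x + y).
Proof.
move=> /sadjP hx /sadjP hy; apply/sadjP => u v.
by rewrite !bop_addE rdotDl rdotDr hx hy.
Qed.

Lemma sadjZ t x : sadj x -> sadj (t%:C *: x).
Proof.
move=> /sadjP hx; apply/sadjP => u v.
by rewrite !bop_scaleE rdotZl rdotZr hx.
Qed.

Lemma sadjN x : sadj x -> sadj (- x).
Proof. by move=> /(sadjZ (-1)); rewrite rmorphN1 scaleN1r. Qed.

Lemma sadjB x y : sadj x -> sadj y -> sadj (x - y).
Proof. by move=> hx /sadjN hy; exact: sadjD. Qed.

Lemma sadj_mul3 x y : sadj x -> sadj y -> sadj (x * y * x).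
Proof. by move=> hx hy u v /=; rewrite hx hy hx. Qed.

Lemma sadjX x n : sadj x -> sadj (x ^+ n).
Proof.
move=> hx; elim: n => [|n IH]; first exact: sadj1.
by move=> u v; rewrite {1}exprS exprSr /= hx IH.
Qed.

Lemma sadj_jordan x y : sadj x -> sadj y -> sadj (x * y + y * x).
Proof.
move=> /sadjP hx /sadjP hy; apply/sadjP => u v.
by rewrite !bop_addE !bop_mulE rdotDl rdotDr hx hy hy hx addrC.
Qed.

Lemma sadj_lim (x : nat -> bop V) l :
  (forall n, sadj (x n)) -> x @ \oo --> l -> sadj l.
Proof.
move=> hx /cvg_rnormP xl; apply/sadjP => u v; apply/eqP; rewrite -subr_eq0 -normr_le0.
apply: (@le_add_cvg0 _ _ _ (fun n => rnorm (x n - l) * (2 * rnorm u * rnorm v))) => [|n].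
  by rewrite -(mul0r (2 * rnorm u * rnorm v)); apply: cvgM => //; exact: cvg_cst.
rewrite add0r.
have /sadjP hn := hx n.
have -> : rdot (l u) v - rdot u (l v) = - rdot ((x n - l) u) v + rdot u ((x n - l) v).
  by rewrite !bop_subE rdotDl rdotDr rdotNl rdotNr hn; ring.
rewrite (le_trans (ler_normD _ _))// normrN.
have -> : rnorm (x n - l) * (2 * rnorm u * rnorm v) =
  rnorm (x n - l) * rnorm u * rnorm v + rnorm u * (rnorm (x n - l) * rnorm v) by ring.
rewrite lerD// (le_trans (rdot_abs _ _))//.
  by rewrite ler_wpM2r ?rnorm_ge0//; exact: rnorm_apply.
by rewrite ler_wpM2l ?rnorm_ge0//; exact: rnorm_apply.
Qed.

Lemma sadj_exp x : sadj x -> sadj (op_exp x).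
Proof.
move=> hx; apply: sadj_lim (sums_exp x) => n.
rewrite /series /=; elim/big_ind : _ => //; first exact: sadj0.
- by move=> *; exact: sadjD.
- by move=> i _; rewrite /exps invfactC; apply/sadjZ/sadjX.
Qed.

(** Half of the C*-identity: |a v|^2 is the inner product of a^2 v and v. *)
Lemma rnorm_sqr_le a : sadj a -> rnorm a ^+ 2 <= rnorm (a * a).
Proof.
move=> /sadjP ha; have aa := rnorm_ge0 (a * a).
rewrite -(sqr_sqrtr aa) lerXn2r ?nnegrE ?sqrtr_ge0 ?rnorm_ge0//.
apply: rnorm_bop_le => [|v]; first exact: sqrtr_ge0.
rewrite -(@ler_pXn2r _ 2)// ?nnegrE ?mulr_ge0 ?sqrtr_ge0 ?rnorm_ge0//.
rewrite exprMn sqr_sqrtr// -rdotvv ha rdotC (le_trans (rdot_le _ _))//.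
by rewrite expr2 mulrA ler_wpM2r ?rnorm_ge0//; exact: (rnorm_apply (a * a)).
Qed.

Lemma rnorm_exp_half a m : 0 <= m -> sadj a ->
  rnorm (op_exp (a + a)) <= m ^+ 2 -> rnorm (op_exp a) <= m.
Proof.
move=> m0 ha am; rewrite -(@ler_pXn2r _ 2)// ?nnegrE ?rnorm_ge0//.
by rewrite (le_trans (rnorm_sqr_le (sadj_exp ha)))// -op_expD.
Qed.

Lemma rdot_exp h v : sadj h ->
  rdot (op_exp h v) v = rnorm (op_exp ((2^-1)%:C *: h) v) ^+ 2.
Proof.
move=> hh; rewrite {1}(half_split h) op_expD// bop_mulE -rdotvv.
by have /sadjP -> := sadj_exp (sadjZ 2^-1 hh).
Qed.

Lemma rdot_exp_ge0 h v : sadj h -> 0 <= rdot (op_exp h v) v.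
Proof. by move=> hh; rewrite rdot_exp// sqr_ge0. Qed.

(** With k = h/2, the inner product of e^h v and v is |e^k v|^2, and
    v = e^(-k) (e^k v) with |e^(-k)|^2 <= |e^(-h)|. *)
Lemma exp_lower h v : sadj h ->
  rnorm v ^+ 2 <= rnorm (op_exp (- h)) * rdot (op_exp h v) v.
Proof.
move=> hh; pose k := (2^-1)%:C *: h.
have hk : sadj k by exact: sadjZ.
have eNk : op_exp (- h) = op_exp (- k) * op_exp (- k).
  by rewrite -op_expD// -opprD -half_split.
rewrite rdot_exp// -/k.
have vE : v = op_exp (- k) (op_exp k v).
  by rewrite -[RHS]/((op_exp (- k) * op_exp k) v) op_expVl.
rewrite {1}vE.
have h1 := rnorm_apply (op_exp (- k)) (op_exp k v).
rewrite (le_trans (lerXn2r 2 _ _ h1)) ?nnegrE ?mulr_ge0 ?rnorm_ge0//.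
rewrite exprMn ler_wpM2r ?sqr_ge0// eNk.
by apply: rnorm_sqr_le; apply/sadj_exp/sadjN.
Qed.

(** If p >= c, then |1 - s p| <= 1 - s c + O(s^2) for small s > 0. As
    (1 - s p) x (1 - s p) = x - s (p x + x p) + O(s^2), the norm of x is at most
    (1 - 2 s c) |x| + s |p x + x p| + O(s^2), and s tends to 0. *)
Lemma lyapunov_le p x c : 0 <= c -> sadj p ->
  (forall v, c * rnorm v ^+ 2 <= rdot (p v) v) ->
  2 * c * rnorm x <= rnorm (p * x + x * p).
Proof.
move=> c0 /sadjP hp pc.
have [q qE q0] : exists2 q, q = rnorm p ^+ 2 & 0 <= q by exists (rnorm p ^+ 2); rewrite ?sqr_ge0.
pose K := ((c + q) ^+ 2 + 2 * q) * rnorm x.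
have d0 : 0 < (c + 1)^-1 by rewrite invr_gt0 ltr_wpDl.
apply: (@le_add_small _ _ _ K _ d0) => s s0 sd.
have s1 : s <= 1 by rewrite (le_trans sd)// invf_le1 ?ltr_wpDl// lerDr.
have sc : s * c <= 1.
  rewrite (le_trans (ler_wpM2r c0 sd))// mulrC ler_pdivrMr ?ltr_wpDl// mul1r.
  by rewrite lerDl.
(* the square of z exceeds the bound 1 - 2 s c + s^2 q for |1 - s p|^2 by the
   square of 1 - z *)
pose z := 1 - s * c + s ^+ 2 * q / 2.
have z0 : 0 <= z.
  have e1 : 0 <= s ^+ 2 * q by apply: mulr_ge0 => //; exact: sqr_ge0.
  by rewrite /z; lra.
pose y := 1 - s%:C *: p.
have yz : rnorm y <= z.
  apply: rnorm_bop_le => // v.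
  rewrite -(@ler_pXn2r _ 2)// ?nnegrE ?mulr_ge0 ?rnorm_ge0//.
  rewrite bop_subE bop_scaleE rnormBsqr rnormZ rdotZr rdotC gtr0_norm//.
  have pv := pc v.
  have pv2 : rnorm (p v) ^+ 2 <= q * rnorm v ^+ 2.
    by rewrite qE -exprMn lerXn2r ?nnegrE ?mulr_ge0 ?rnorm_ge0//; exact: rnorm_apply.
  rewrite exprMn.
  have h1 : s * (c * rnorm v ^+ 2) <= s * rdot (p v) v by rewrite ler_wpM2l ?(ltW s0).
  have h2 : s ^+ 2 * rnorm (p v) ^+ 2 <= s ^+ 2 * (q * rnorm v ^+ 2).
    by rewrite ler_wpM2l ?sqr_ge0.
  rewrite exprMn.
  have h3 : 0 <= (s * c - s ^+ 2 * q / 2) ^+ 2 * rnorm v ^+ 2 by rewrite mulr_ge0 ?sqr_ge0.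
  have -> : z ^+ 2 * rnorm v ^+ 2 = rnorm v ^+ 2 - 2 * (s * (c * rnorm v ^+ 2))
     + s ^+ 2 * (q * rnorm v ^+ 2) + (s * c - s ^+ 2 * q / 2) ^+ 2 * rnorm v ^+ 2.
    by rewrite /z; field.
  by lra.
have xE : x = y * x * y + s%:C *: (p * x + x * p) - (s ^+ 2)%:C *: (p * x * p).
  rewrite scalerDr bop_scalerAl (bop_scalerAr _ x p).
  rewrite expr2 rmorphM -scalerA (bop_scalerAr _ (p * x) p) !bop_scalerAl.
  by rewrite /y sandwich1B addrAC addrK subrK.
have h1 : rnorm x <= z ^+ 2 * rnorm x + s * rnorm (p * x + x * p) + s ^+ 2 * (q * rnorm x).
  rewrite {1}xE (le_trans (rnormB _ _))// lerD//; last first.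
    rewrite rnormZ ger0_norm ?sqr_ge0// ler_wpM2l ?sqr_ge0//.
    rewrite (le_trans (rnormM _ _))// mulrC qE expr2 -mulrA ler_wpM2l ?rnorm_ge0//.
    exact: rnormM.
  rewrite (le_trans (rnormD _ _))// lerD//; last by rewrite rnormZ gtr0_norm.
  rewrite (le_trans (rnormM _ _))// mulrC expr2 -mulrA ler_pM ?rnorm_ge0//.
  by rewrite (le_trans (rnormM _ _))// ler_wpM2r ?rnorm_ge0.
have h2 : (s * c - s ^+ 2 * q / 2) ^+ 2 <= s ^+ 2 * (c + q) ^+ 2.
  rewrite -[leRHS]exprMn -[leLHS]real_normK ?num_real// lerXn2r ?nnegrE ?mulr_ge0 ?addr_ge0 ?(ltW s0)//.
  rewrite mulrDr (le_trans (ler_normB _ _))// lerD// ger0_norm//.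
  - by rewrite mulr_ge0// ltW.
  - rewrite expr2 -!mulrA ler_wpM2l ?(ltW s0)// mulrA.
    have : s * q <= 1 * q by rewrite ler_wpM2r.
    by have := mulr_ge0 (ltW s0) q0; rewrite mul1r; lra.
  - by apply: divr_ge0 => //; apply: mulr_ge0 => //; exact: sqr_ge0.
have h3 : (s * c - s ^+ 2 * q / 2) ^+ 2 * rnorm x <= s ^+ 2 * (c + q) ^+ 2 * rnorm x.
  by rewrite ler_wpM2r ?rnorm_ge0.
have zE : z ^+ 2 * rnorm x = rnorm x - s * (2 * c * rnorm x) + s ^+ 2 * q * rnorm x
   + (s * c - s ^+ 2 * q / 2) ^+ 2 * rnorm x by rewrite /z; field.
rewrite -(ler_pM2l s0).
have -> : s * (rnorm (p * x + x * p) + s * K) = s * rnorm (p * x + x * p)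
  + s ^+ 2 * (c + q) ^+ 2 * rnorm x + s ^+ 2 * (q * rnorm x) + s ^+ 2 * q * rnorm x.
  by rewrite /K; ring.
by lra.
Qed.

(** For P = e^h + e^k and X = e^h - e^k one has P X + X P = 2 (e^2h - e^2k), and
    P >= 2/m because |e^(-h)| and |e^(-k)| are at most m; apply
    [lyapunov_le]. *)
Lemma exp_sub_half h k m : 0 < m -> sadj h -> sadj k ->
  rnorm (op_exp (- (h + h))) <= m ^+ 2 -> rnorm (op_exp (- (k + k))) <= m ^+ 2 ->
  2 * rnorm (op_exp h - op_exp k) <= m * rnorm (op_exp (h + h) - op_exp (k + k)).
Proof.
move=> m0 hh hk hm km.
have low a v : sadj a -> rnorm (op_exp (- (a + a))) <= m ^+ 2 ->
    m^-1 * rnorm v ^+ 2 <= rdot (op_exp a v) v.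
  move=> ha am; rewrite ler_pdivrMl//.
  have am' : rnorm (op_exp (- a)) <= m.
    by apply: rnorm_exp_half; [exact: ltW|exact: sadjN|rewrite -opprD].
  apply: (le_trans (exp_lower v ha)); apply: ler_wpM2r => //.
  exact: rdot_exp_ge0.
have hp : sadj (op_exp h + op_exp k) by apply: sadjD; exact: sadj_exp.
have lowp v : 2 * m^-1 * rnorm v ^+ 2 <= rdot ((op_exp h + op_exp k) v) v.
  rewrite bop_addE rdotDl.
  have -> : 2 * m^-1 * rnorm v ^+ 2 = m^-1 * rnorm v ^+ 2 + m^-1 * rnorm v ^+ 2.
    by ring.
  by apply: lerD; [exact: low hh hm|exact: low hk km].
have m2 : 0 <= 2 * m^-1 by rewrite mulr_ge0// invr_ge0 ltW.
have := lyapunov_le (op_exp h - op_exp k) m2 hp lowp.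
have -> : (op_exp h + op_exp k) * (op_exp h - op_exp k) +
   (op_exp h - op_exp k) * (op_exp h + op_exp k) =
   (op_exp (h + h) - op_exp (k + k)) *+ 2.
  by rewrite !op_expD// jordan_sub_sqr.
rewrite rnormMn => le; rewrite -ler_pdivrMl//.
by move: le; rewrite -!mulrA !ler_pM2l// => le; rewrite mulrCA.
Qed.

End Hilbert.

Lemma sub_via_remainders (E : zmodType) (a b c d o : E) :
  a - b = (c - d) - (c - o - a) + (d - o - b).
Proof.
rewrite -!(addrA _ (- o)) -!opprD opprB [c - d + _]addrC subrKA subrKA.
by rewrite [o + a]addrC addrKA.
Qed.

Section LogLip.
Variables (R : realType) (V : completeNormedModType R[i]).
Variable dot : {dot V for @Num.conj R[i]}.
Hypothesis hV : hilbert_norm dot.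
Implicit Types (u v : V) (x y h k a p w : bop V) (s t c m : R).
Local Notation sadj := (sadj dot).

(** Iterating [exp_sub_half], the constants multiply to
    e^(c/2 + c/4 + ... + c/2^n). *)
Lemma exp_sub_dyadic n h k c : 0 <= c -> sadj h -> sadj k ->
  rnorm (op_exp (- h)) <= expR c -> rnorm (op_exp (- k)) <= expR c ->
  2 ^+ n * rnorm (op_exp ((2^-1 ^+ n)%:C *: h) - op_exp ((2^-1 ^+ n)%:C *: k))
  <= expR (c - c * 2^-1 ^+ n) * rnorm (op_exp h - op_exp k).
Proof.
elim: n h k c => [|n IH] h k c c0 hh hk hm km.
  by rewrite !expr0 mul1r !scale1r mulr1 subrr expR0 mul1r.
have e2 : expR c = expR (c / 2) ^+ 2.
  by rewrite -expRM_natl -mulr_natl mulrCA mulfV ?mulr1 ?pnatr_eq0.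
have half x : (2^-1 ^+ n.+1)%:C *: x = (2^-1 ^+ n)%:C *: ((2^-1)%:C *: x).
  by rewrite scalerA -rmorphM exprSr.
rewrite !half; set h' := (2^-1)%:C *: h; set k' := (2^-1)%:C *: k.
have hE : h = h' + h' := half_split h.
have kE : k = k' + k' := half_split k.
have sh' : sadj h' by exact: sadjZ.
have sk' : sadj k' by exact: sadjZ.
have c20 : 0 <= c / 2 by rewrite divr_ge0.
have half_le x : sadj x -> rnorm (op_exp (- (x + x))) <= expR c -> rnorm (op_exp (- x)) <= expR (c / 2).
  move=> hx; rewrite e2 opprD; apply: (rnorm_exp_half hV); first exact: expR_ge0.
  exact: sadjN.
have hm' : rnorm (op_exp (- (h' + h'))) <= expR c by rewrite -hE.
have km' : rnorm (op_exp (- (k' + k'))) <= expR c by rewrite -kE.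
have := IH h' k' (c / 2) c20 sh' sk' (half_le _ sh' hm') (half_le _ sk' km').
rewrite e2 in hm' km'.
have := exp_sub_half hV (expR_gt0 (c / 2)) sh' sk' hm' km'.
rewrite -hE -kE.
move: (rnorm _) (rnorm (op_exp h' - _)) (rnorm (op_exp h - _)) => d'' d d' h1 h2.
rewrite exprS -mulrA.
have -> : c - c * 2^-1 ^+ n.+1 = c / 2 + (c / 2 - c / 2 * 2^-1 ^+ n).
  by rewrite exprS; field.
rewrite expRD -mulrA [expR _ * (_ * _)]mulrCA.
have h3 := ler_wpM2l (expR_ge0 (c / 2 - c / 2 * 2^-1 ^+ n)) h1.
apply: le_trans h3; rewrite [leRHS]mulrCA; exact: ler_wpM2l.
Qed.

(** 2^n (e^(h/2^n) - e^(k/2^n)) tends to h - k, and [exp_sub_dyadic] bounds it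
    uniformly in n. *)
Lemma log_lip h k c : 0 <= c -> sadj h -> sadj k ->
  rnorm (op_exp (- h)) <= expR c -> rnorm (op_exp (- k)) <= expR c ->
  rnorm (h - k) <= expR c * rnorm (op_exp h - op_exp k).
Proof.
move=> c0 hh hk hm km.
pose K x := rnorm x ^+ 2 * expR (rnorm x).
apply: (@le_add_cvg0 _ _ _ (fun n => (2^-1 ^+ n) * (K h + K k))) => [|n].
  by rewrite -(mul0r (K h + K k)); apply: cvgM; [exact: cvg_half|exact: cvg_cst].
set e := 2^-1 ^+ n; have e0 : 0 < e by rewrite exprn_gt0 ?invr_gt0.
have e1 : e <= 1 by rewrite exprn_ile1 ?invr_ge0// invf_le1// ler1n.
have loc x : rnorm (op_exp (e%:C *: x) - 1 - e%:C *: x) <= e * (e * K x).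
  rewrite (le_trans (rnorm_exp_sub1x _))// rnormZ gtr0_norm// exprMn /K expr2 -!mulrA.
  rewrite !ler_wpM2l ?sqr_ge0 ?(ltW e0)// ?ler_expR ?ler_piMl ?rnorm_ge0//.
have dy := exp_sub_dyadic n c0 hh hk hm km; rewrite -/e in dy.
have dec : e%:C *: (h - k) = (op_exp (e%:C *: h) - op_exp (e%:C *: k))
    - (op_exp (e%:C *: h) - 1 - e%:C *: h) + (op_exp (e%:C *: k) - 1 - e%:C *: k).
  by rewrite scalerBr; exact: sub_via_remainders.
have : e * rnorm (h - k) <= e * (expR c * rnorm (op_exp h - op_exp k) + e * (K h + K k)).
  rewrite -{1}[e]gtr0_norm// -rnormZ dec mulrDr [e * (K h + K k)]mulrDr mulrDr [leRHS]addrA.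
  rewrite (le_trans (rnormD _ _))// lerD// (le_trans (rnormB _ _))// lerD//.
  have e2 : e * 2 ^+ n = 1 by rewrite /e -exprMn mulVf ?expr1n// pnatr_eq0.
  rewrite -[leLHS]mul1r -e2 -mulrA; apply: ler_wpM2l; first exact: ltW.
  apply: (le_trans dy); apply: ler_wpM2r; first exact: rnorm_ge0.
  by rewrite ler_expR lerBlDr lerDl; apply: mulr_ge0 => //; exact: ltW.
by rewrite ler_pM2l.
Qed.

Lemma op_exp_inj h k : sadj h -> sadj k -> op_exp h = op_exp k -> h = k.
Proof.
move=> hh hk e; apply/eqP; rewrite -subr_eq0; apply/eqP/rnorm_le0.
have c0 : 0 <= rnorm h + rnorm k by rewrite addr_ge0 ?rnorm_ge0.
rewrite (le_trans (log_lip c0 hh hk _ _))//.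
- by rewrite (le_trans (rnorm_exp _))// rnormN ler_expR lerDl rnorm_ge0.
- by rewrite (le_trans (rnorm_exp _))// rnormN ler_expR lerDr rnorm_ge0.
- by rewrite e subrr rnorm0 mulr0.
Qed.

Lemma op_logK h : sadj h -> op_log dot (op_exp h) = h.
Proof.
move=> hh; rewrite /op_log; case: xgetP => [k _ [hk ek]|no].
  exact: op_exp_inj.
by have := no h; case.
Qed.

(** By [log_lip], |s w| <= e^r |e^(2k + s w) - e^(2k)| as soon as r bounds
    |2k| + |s w|, and e^(2k + s w) - e^(2k) = s e^k S_k(w) e^k + O(s^2); divide
    by s and let s tend to 0. *)
Lemma sinhc_lower k w : sadj k -> sadj w ->
  rnorm w <= expR (4 * rnorm k + 1) * rnorm (sinhc k w).
Proof.
move=> hk hw; pose r := 2 * rnorm k + 1.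
have r0 : 0 <= r by rewrite addr_ge0 ?mulr_ge0 ?rnorm_ge0.
have kk : rnorm (k + k) <= 2 * rnorm k by rewrite mulr2n mulrDl mul1r rnormD.
pose D := op_exp k * sinhc k w * op_exp k.
have DS : rnorm D <= expR (2 * rnorm k) * rnorm (sinhc k w).
  rewrite (le_trans (rnormM _ _))// mulr2n mulrDl mul1r expRD -mulrA [leRHS]mulrCA mulrC ler_pM ?rnorm_ge0 ?rnorm_exp//.
  by rewrite (le_trans (rnormM _ _))// ler_wpM2r ?rnorm_ge0 ?rnorm_exp.
suff : rnorm w <= expR r * rnorm D.
  move=> /le_trans; apply.
  have -> : 4 * rnorm k + 1 = r + 2 * rnorm k by rewrite /r; ring.
  by rewrite (expRD r) -mulrA ler_wpM2l ?expR_ge0.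
have d0 : 0 < (rnorm w + 1)^-1 by rewrite invr_gt0 ltr_wpDl ?rnorm_ge0.
apply: (@le_add_small _ _ _ (expR r * (rnorm w ^+ 2 * expR r)) _ d0) => s s0 sd.
have sw : rnorm (s%:C *: w) <= 1.
  rewrite rnormZ gtr0_norm// (le_trans (ler_wpM2r (rnorm_ge0 w) sd))// mulrC.
  by rewrite ler_pdivrMr ?ltr_wpDl ?rnorm_ge0// mul1r lerDl.
have hr : rnorm (k + k) + rnorm (s%:C *: w) <= r by rewrite lerD.
have hkk : sadj (k + k) by exact: sadjD.
have hkw : sadj (k + k + s%:C *: w) by apply: sadjD => //; exact: sadjZ.
have hr1 : rnorm (k + k + s%:C *: w) <= r by rewrite (le_trans (rnormD _ _)).
have hr2 : rnorm (k + k) <= r by rewrite (le_trans _ hr)// lerDl rnorm_ge0.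
have ball (x : bop V) : rnorm x <= r -> rnorm (op_exp (- x)) <= expR r.
  by move=> xr; apply: (le_trans (rnorm_exp _)); rewrite rnormN ler_expR.
have h1 := log_lip r0 hkw hkk (ball _ hr1) (ball _ hr2).
rewrite [k + k + _]addrC addrK [s%:C *: w + _]addrC rnormZ gtr0_norm// in h1.
have := op_exp_taylor hr.
have -> : sinhc k (s%:C *: w) = s%:C *: sinhc k w by rewrite linearZ.
rewrite -bop_scalerAr -bop_scalerAl -/D rnormZ gtr0_norm// => h2.
rewrite -(ler_pM2l s0); apply: (le_trans h1).
have -> : s * (expR r * rnorm D + s * (expR r * (rnorm w ^+ 2 * expR r)))
  = expR r * (s * rnorm D + (s * rnorm w) ^+ 2 * expR r) by ring.
rewrite ler_wpM2l ?expR_ge0// -[op_exp _ - _](subrK (s%:C *: D)).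
rewrite (le_trans (rnormD _ _))// [leRHS]addrC; apply: lerD => //.
by rewrite rnormZ gtr0_norm.
Qed.

End LogLip.

(** * Subspaces stable under double commutators *)

Lemma sandwich1D (K : pzRingType) (q a r : K) :
  (1 + (a + r)) * q * (1 + (a + r)) - q - (a * q + q * a) =
  (r * q + q * r) + (a + r) * q * (a + r).
Proof.
set d := a + r; rewrite (mulrDl 1 d q) mul1r mulrDr mulr1 (mulrDl q _ d).
rewrite -[q + _ + _]addrA [q + _]addrC addrK [d * q + _]addrA [LHS]addrAC; congr (_ + _).
by rewrite /d mulrDl mulrDr addrACA addrAC subrr add0r.
Qed.

Definition seq_closed (T : topologicalType) (H : set T) : Prop :=
  forall (u : nat -> T) (l : T), (forall n, H (u n)) -> u @ \oo --> l -> H l.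

Lemma closed_seq_closed (T : topologicalType) (H : set T) : closed H -> seq_closed H.
Proof. by move=> hH u l hu ul; apply: (closed_cvg H hH _ _ ul); exact: nearW. Qed.

Section RealSubspace.
Variables (R : realType) (V : completeNormedModType R[i]) (H : set (bop V)).
Hypotheses (Hsub : real_subspace H) (Hclosed : seq_closed H).
Implicit Types (x y : bop V) (t : R).

Lemma subspaceD x y : H x -> H y -> H (x + y). Proof. by case: Hsub => _ + _; apply. Qed.
Lemma subspaceZ t x : H x -> H (t%:C *: x). Proof. by case: Hsub => _ _; apply. Qed.
Lemma subspace0 : H 0. Proof. by case: Hsub. Qed.
Lemma subspaceN x : H x -> H (- x).
Proof. by move=> /(subspaceZ (-1)); rewrite rmorphN1 scaleN1r. Qed.
Lemma subspaceB x y : H x -> H y -> H (x - y).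
Proof. by move=> hx /subspaceN; exact: subspaceD. Qed.

Lemma subspace_sums (a : nat -> bop V) s : (forall n, H (a n)) -> sums a s -> H s.
Proof.
move=> ha; apply: Hclosed => n; rewrite /series /=.
elim/big_ind : _ => //; first exact: subspace0.
by move=> *; exact: subspaceD.
Qed.

(** A Neumann series on H, where f has an inverse bounded by C: solving with f
    instead of g leaves the remainders [y_ n], which halve at each step. *)
Lemma perturbed_onto (f g : bop (bop V)) (C : R) : 0 < C ->
  (forall w, H w -> H (f w)) -> (forall w, H w -> H (g w)) ->
  (forall w, H w -> rnorm w <= C * rnorm (f w)) ->
  rnorm (g - f) <= (2 * C)^-1 ->
  (forall y, H y -> exists2 w, H w & f w = y) ->
  forall y, H y -> exists2 w, H w & g w = y.
Proof.
move=> C0 fH gH fC gf fsurj y hy.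
have /choice[inv hinv] z : exists w, H z -> H w /\ f w = z.
  by have [/fsurj[w hw <-]|no] := pselect (H z); [exists w|exists 0].
pose y_ n := iter n (fun z => z - g (inv z)) y.
have Hy_ n : H (y_ n).
  by elim: n => // n IH; apply: subspaceB => //; apply: gH; case: (hinv _ IH).
have hw n : H (inv (y_ n)) by case: (hinv _ (Hy_ n)).
have fw n : f (inv (y_ n)) = y_ n by case: (hinv _ (Hy_ n)).
have yS n : y_ n.+1 = y_ n - g (inv (y_ n)) by [].
have wle n : rnorm (inv (y_ n)) <= C * rnorm (y_ n) by rewrite -{2}(fw n); exact: fC.
have yle n : rnorm (y_ n) <= rnorm y * 2^-1 ^+ n.
  elim: n => [|n IH]; first by rewrite expr0 mulr1.
  rewrite yS -{1}(fw n) rnormC -bop_subE (le_trans (rnorm_apply _ _))//.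
  rewrite (le_trans (ler_pM _ _ gf (wle n))) ?rnorm_ge0//.
  rewrite invfM -mulrA mulKf ?gt_eqF// exprS mulrCA ler_wpM2l ?invr_ge0//.
have bnd n : rnorm (inv (y_ n)) <= (C * rnorm y) * 2^-1 ^+ n.
  by rewrite (le_trans (wle n))// -mulrA ler_wpM2l ?(ltW C0).
have geo : rsums (fun n => (C * rnorm y) * 2^-1 ^+ n) (C * rnorm y / (1 - 2^-1)).
  apply: cvg_geometric_series.
  by rewrite ger0_norm ?invr_ge0// invf_lt1// ltr1n.
have [w sw _] := dominated_sums bnd geo.
exists w; first exact: subspace_sums sw.
have tele n : series (fun n => g (inv (y_ n))) n = y - y_ n.
  elim: n => [|n IH]; first by rewrite /series /= big_geq// subrr.
  by rewrite seriesSr IH yS opprB -addrA [- _ + _]addrC.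
have h1 : sums (fun n => g (inv (y_ n))) (g w).
  apply: (sums_map (g := g) (c := rnorm g) _ _ sw); first exact: linearD.
  exact: rnorm_apply.
apply: (sums_unique h1).
apply: (@cvg_rnorm_squeeze _ _ _ _ (fun n => rnorm y * 2^-1 ^+ n)) => [n|].
  rewrite tele addrAC subrr add0r rnormN; exact: yle.
by rewrite -(mulr0 (rnorm y)); apply: cvgM; [exact: cvg_cst|exact: cvg_half].
Qed.

End RealSubspace.

Section TripleSystem.
Variables (R : realType) (V : completeNormedModType R[i]).
Variable dot : {dot V for @Num.conj R[i]}.
Hypothesis hV : hilbert_norm dot.
Variable H : set (bop V).
Hypotheses (Hsub : real_subspace H) (Hclosed : seq_closed H).
Hypothesis Hsa : forall x, H x -> sadj dot x.
Hypothesis Htriple : forall x y, H x -> H y -> H (commutator x (commutator x y)).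
Implicit Types (x y h k a w : bop V) (s t : R) (c : nat -> R).
Local Notation sadj := (sadj dot).

Lemma ad_even_stable k w m : H k -> H w -> H ((ad k ^+ m.*2) w).
Proof.
move=> hk hw; elim: m => [|m IH]; first by rewrite expr0.
by rewrite doubleS !exprS !bop_mulE; exact: Htriple.
Qed.

(** The odd terms cancel, and the even ones are iterated double commutators. *)
Lemma even_series_stable c k (f : bop (bop V)) w : H k -> H w ->
  sums (fun n => (c n)%:C *: ad k ^+ n + (c n)%:C *: (- ad k) ^+ n) f -> H (f w).
Proof.
move=> hk hw /(sums_apply w); apply: subspace_sums => // n.
rewrite exprNn bop_addE !bop_scaleE.
have [od|ev] := boolP (odd n).
  rewrite -signr_odd od expr1 mulN1r -[(- _ : bop _) w]/(- (ad k ^+ n) w).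
  by rewrite scalerN subrr; exact: subspace0.
rewrite -signr_odd (negbTE ev) expr0 mul1r -(odd_double_half n) (negbTE ev) add0n.
by apply: subspaceD => //; apply: subspaceZ => //; exact: ad_even_stable.
Qed.

Lemma sinhc_stable k w : H k -> H w -> H (sinhc k w).
Proof.
move=> hk hw; rewrite /sinhc bop_scaleE; apply: subspaceZ => //.
apply: (even_series_stable (c := fun n => n.+1`!%:R^-1) hk hw).
have h := sumsD (sums_phi (ad k)) (sums_phi (- ad k)).
by apply: sums_ext h => n; rewrite /phis !invfactC.
Qed.

Lemma cosh_stable k w : H k -> H w ->
  H (op_exp k * w * op_exp (- k) + op_exp (- k) * w * op_exp k).
Proof.
move=> hk hw.
have adN : ad (- k) = - ad k by rewrite /ad lmulN rmulN opprB addrC opprK.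
have -> : op_exp (- k) * w * op_exp k = op_exp (- ad k) w.
  by rewrite -adN op_exp_ad opprK.
rewrite -op_exp_ad -bop_addE.
apply: (even_series_stable (c := fun n => n`!%:R^-1) hk hw).
have h := sumsD (sums_exp (ad k)) (sums_exp (- ad k)).
by apply: sums_ext h => n; rewrite /exps !invfactC.
Qed.

Lemma adZ t k : ad (t%:C *: k) = t%:C *: ad k.
Proof.
apply/bopP => x; rewrite bop_scaleE /ad !bop_subE /=.
by rewrite scalerBr bop_scalerAl bop_scalerAr.
Qed.

Lemma sinhc_lip k s t : 0 <= s <= 1 -> 0 <= t <= 1 ->
  rnorm (sinhc (s%:C *: k) - sinhc (t%:C *: k)) <= `|s - t| * expR (2 * rnorm k).
Proof.
move=> hs ht; rewrite /sinhc -scalerBr rnormZ !adZ -!scalerN.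
rewrite [- (phi _ + phi _)]opprD addrACA ger0_norm ?invr_ge0//.
have aux (T : bop (bop V)) : rnorm T <= 2 * rnorm k ->
    rnorm (phi (s%:C *: T) - phi (t%:C *: T)) <= `|s - t| * expR (2 * rnorm k).
  move=> hT; rewrite (le_trans (rnorm_phi_lip _ hs ht))// ler_wpM2l// ler_expR//.
have h1 := aux _ (rnorm_ad k).
have := aux (- ad k); rewrite rnormN => /(_ (rnorm_ad k)) h2.
rewrite mulrC ler_pdivrMr; last exact: ltr0n.
apply: (le_trans (rnormD _ _)); apply: (le_trans (lerD h1 h2)).
by rewrite mulr_natr mulr2n.
Qed.

Lemma sinhc0 : sinhc (0 : bop V) = 1.
Proof.
have -> : (0 : bop V) = (0 : R)%:C *: (0 : bop V) by rewrite scaler0.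
by rewrite /sinhc adZ scale0r oppr0 phi0 -mulr2n scaler_half_double.
Qed.

(** Method of continuity along s |-> S_(s k), from S_0 = 1: the lower bound
    [sinhc_lower] is uniform in s, so finitely many small steps suffice. *)
Lemma sinhc_onto k y : H k -> H y -> exists2 w, H w & sinhc k w = y.
Proof.
move=> hk hy.
pose C := expR (4 * rnorm k + 1); have C0 : 0 < C by exact: expR_gt0.
pose L := expR (2 * rnorm k); have L0 : 0 < L by exact: expR_gt0.
pose N := (Num.truncn (2 * C * L)).+1.
have NC : 2 * C * L < N%:R by apply: truncnS_gt.
have N0 : 0 < N%:R :> R by rewrite ltr0n.
pose s j : R := j%:R / N%:R.
have s01 j : (j <= N)%N -> 0 <= s j <= 1.
  by move=> jN; rewrite divr_ge0//= ler_pdivrMr// mul1r ler_nat.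
suff main j : (j <= N)%N -> forall y, H y -> exists2 w, H w & sinhc ((s j)%:C *: k) w = y.
  have [w hw we] := main N (leqnn N) y hy; exists w => //; rewrite -we.
  by have -> : s N = 1 by [rewrite /s mulfV ?gt_eqF]; rewrite scale1r.
elim: j => [_|j IH jN] {hy}y hy.
  by exists y => //; rewrite /s mul0r scale0r sinhc0.
apply: (perturbed_onto Hsub Hclosed C0 _ _ _ _ (IH (ltnW jN)) hy).
- by move=> w hw; apply: sinhc_stable => //; exact: subspaceZ.
- by move=> w hw; apply: sinhc_stable => //; exact: subspaceZ.
- move=> w hw; have hsk : H ((s j)%:C *: k) by exact: subspaceZ.
  rewrite (le_trans (sinhc_lower hV (Hsa hsk) (Hsa hw)))// ler_wpM2r ?rnorm_ge0//.
  have /andP[sj0 sj1] := s01 j (ltnW jN).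
  by rewrite ler_expR lerD2r ler_wpM2l// rnormZ ger0_norm// ler_piMl ?rnorm_ge0.
- rewrite (le_trans (sinhc_lip k (s01 _ jN) (s01 _ (ltnW jN))))// -/L.
  have -> : s j.+1 - s j = N%:R^-1 by rewrite /s -mulrBl -natrB// subSnn mul1r.
  rewrite gtr0_norm ?invr_gt0// mulrC ler_pdivrMr// mulrC ler_pdivlMr ?mulr_gt0//.
  by rewrite mulrC ltW.
Qed.

Lemma exp_sandwich_taylor (q a : bop V) : rnorm a <= 1 ->
  rnorm (op_exp a * q * op_exp a - q - (a * q + q * a)) <=
  (2 * expR 1 + expR 1 ^+ 2) * rnorm q * rnorm a ^+ 2.
Proof.
move=> a1; pose d := op_exp a - 1; pose r := d - a.
have ea : expR (rnorm a) <= expR 1 by rewrite ler_expR.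
have rr : rnorm r <= rnorm a ^+ 2 * expR 1.
  by rewrite (le_trans (rnorm_exp_sub1x a))// ler_wpM2l ?sqr_ge0.
have dd : rnorm d <= rnorm a * expR 1.
  by rewrite (le_trans (rnorm_exp_sub1 a))// ler_wpM2l ?rnorm_ge0.
have eE : op_exp a = 1 + d by rewrite /d addrC subrK.
have dE : d = a + r by rewrite /r addrC subrK.
have -> : op_exp a * q * op_exp a - q - (a * q + q * a) = (r * q + q * r) + d * q * d.
  by rewrite eE dE sandwich1D.
have r2 : rnorm (r * q + q * r) <= 2 * (rnorm a ^+ 2 * expR 1 * rnorm q).
  rewrite (le_trans (rnormD _ _))// [in leRHS]mulr2n [in leRHS]mulrDl [in leRHS]mul1r lerD// (le_trans (rnormM _ _))//.
    by rewrite ler_wpM2r ?rnorm_ge0.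
  by rewrite mulrC ler_wpM2r ?rnorm_ge0.
have d2 : rnorm (d * q * d) <= (rnorm a * expR 1) * rnorm q * (rnorm a * expR 1).
  rewrite (le_trans (rnormM _ _))// ler_pM ?rnorm_ge0// (le_trans (rnormM _ _))//.
  by rewrite ler_wpM2r ?rnorm_ge0.
rewrite (le_trans (rnormD _ _))//.
have -> : (2 * expR 1 + expR 1 ^+ 2) * rnorm q * rnorm a ^+ 2 =
  2 * (rnorm a ^+ 2 * expR 1 * rnorm q) + (rnorm a * expR 1) * rnorm q * (rnorm a * expR 1).
  by ring.
exact: lerD.
Qed.

(** One Euler step. To first order e^a e^h e^a is e^h + a e^h + e^h a, and with
    k = h/2 the increment is e^k x e^k for x = 2 cosh (ad k) a in H. The step
    w = S_k^-1 x gives e^(h + w) the same first-order increment. *)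
Lemma euler_step (r : R) : exists2 C, 0 <= C & forall h a, H h -> rnorm h <= r ->
  H a -> rnorm a <= 1 ->
  exists2 h', H h' & rnorm (op_exp h' - op_exp a * op_exp h * op_exp a) <= C * rnorm a ^+ 2.
Proof.
have [r0|rneg] := leP 0 r; last first.
  exists 0 => // h a _ hr; exfalso.
  by move: (le_lt_trans hr rneg); rewrite ltNge rnorm_ge0.
pose W := expR (2 * r + 1) * (2 * expR r).
have W0 : 0 <= W by rewrite !mulr_ge0 ?expR_ge0.
have e0 : 0 <= 2 * expR 1 + expR 1 ^+ 2 :> R.
  by apply: addr_ge0; [apply: mulr_ge0 => //; exact: expR_ge0|exact: sqr_ge0].
exists (W ^+ 2 * expR (r + W) + (2 * expR 1 + expR 1 ^+ 2) * expR r).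
  by apply: addr_ge0; apply: mulr_ge0 => //; rewrite ?expR_ge0 ?sqr_ge0.
move=> h a hh hr ha a1; pose k := (2^-1)%:C *: h.
have hk : H k by exact: subspaceZ.
have hE : h = k + k := half_split h.
have kr : rnorm k = rnorm h / 2 by rewrite rnormZ gtr0_norm ?invr_gt0// mulrC.
have kexp : expR (rnorm k) * expR (rnorm k) <= expR r.
  by rewrite -expRD ler_expR kr -splitr.
pose x := op_exp k * a * op_exp (- k) + op_exp (- k) * a * op_exp k.
have hx : H x by exact: cosh_stable.
have xa : rnorm x <= 2 * expR r * rnorm a.
  have aux (u v : bop V) : rnorm u <= expR (rnorm k) -> rnorm v <= expR (rnorm k) ->
      rnorm (u * a * v) <= expR r * rnorm a.
    move=> hu hv; rewrite (le_trans (rnormM _ _))//.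
    rewrite (le_trans (ler_pM _ _ (rnormM _ _) hv)) ?rnorm_ge0//.
    rewrite mulrAC ler_wpM2r ?rnorm_ge0// (le_trans _ kexp)// ler_wpM2r ?expR_ge0//.
  rewrite (le_trans (rnormD _ _))// -[leRHS]mulrA [in leRHS]mulr2n [in leRHS]mulrDl [in leRHS]mul1r lerD// aux ?rnorm_exp//.
    by rewrite (le_trans (rnorm_exp _))// rnormN.
  by rewrite (le_trans (rnorm_exp _))// rnormN.
have [w hw wx] := sinhc_onto hk hx.
have wa : rnorm w <= W * rnorm a.
  rewrite (le_trans (sinhc_lower hV (Hsa hk) (Hsa hw)))// wx /W -mulrA.
  rewrite ler_pM ?rnorm_ge0 ?expR_ge0// ler_expR lerD2r kr.
  by move: hr; move: (rnorm h) => n hr; lra.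
have wW : rnorm w <= W by rewrite (le_trans wa)// ler_piMr.
exists (h + w); first exact: subspaceD.
have rw : rnorm (k + k) + rnorm w <= r + W by rewrite -hE lerD.
have := op_exp_taylor rw; rewrite wx.
have -> : op_exp k * x * op_exp k = a * op_exp h + op_exp h * a.
  rewrite /x mulrDr mulrDl !mulrA op_expVr mul1r.
  rewrite -[_ * op_exp (- k) * _]mulrA op_expVl mulr1 addrC hE op_expD//.
  by rewrite !mulrA.
rewrite -hE => h1.
have h2 := exp_sandwich_taylor (op_exp h) a1.
have eh : rnorm (op_exp h) <= expR r by rewrite (le_trans (rnorm_exp _))// ler_expR.
set X := op_exp (h + w); set Y := op_exp a * _ * _; set Z := a * _ + _ in h1 h2 *.
have -> : X - Y = (X - op_exp h - Z) - (Y - op_exp h - Z).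
  by rewrite -!(addrA _ (- op_exp h)) -!opprD opprB addrA subrK.
rewrite (le_trans (rnormB _ _))// mulrDl lerD//.
  rewrite (le_trans h1)// [leRHS]mulrAC ler_wpM2r ?expR_ge0// -[leRHS]exprMn.
  by apply: lerXn2r => //; rewrite nnegrE ?rnorm_ge0//; apply: mulr_ge0 => //; exact: rnorm_ge0.
by rewrite (le_trans h2)// ler_wpM2r ?sqr_ge0// ler_wpM2l.
Qed.

End TripleSystem.

(** * Stability of e^H under (p, q) |-> p q p *)

Section OneParameter.
Variables (R : realType) (W : completeNormedModType R[i]).
Implicit Types (x : bop W) (s t : R).

Lemma op_exp_line x s t :
  op_exp (s%:C *: x) * op_exp (t%:C *: x) = op_exp ((s + t)%:C *: x).
Proof.
rewrite rmorphD scalerDl op_expD//.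
by rewrite -!bop_scalerAl -!bop_scalerAr !scalerA mulrC.
Qed.

Lemma rnorm_exp_line x s : `|s| <= 1 -> rnorm (op_exp (s%:C *: x)) <= expR (rnorm x).
Proof.
by move=> s1; rewrite (le_trans (rnorm_exp _))// rnormZ ler_expR ler_piMl ?rnorm_ge0.
Qed.

Lemma rnorm_mul3 (a b c : bop W) (r r' r'' : R) : rnorm a <= r -> rnorm b <= r' -> rnorm c <= r'' ->
  rnorm (a * b * c) <= r * r' * r''.
Proof.
move=> ha hb hc; rewrite (le_trans (rnormM _ _))// ler_pM ?rnorm_ge0//.
by rewrite (le_trans (rnormM _ _))// ler_pM ?rnorm_ge0.
Qed.

Lemma rnorm_inv_near (q q' y y' : bop W) (b : R) : 0 < b -> q' * q = 1 -> y * y' = 1 ->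
  rnorm y' <= b -> rnorm (q - y) <= (2 * b)^-1 -> rnorm q' <= 2 * b.
Proof.
move=> b0 qq yy yb qy.
have qb : rnorm q' <= b + rnorm q' * (2 * b)^-1 * b.
  have {1}-> : q' = y' + q' * (y - q) * y'.
    by rewrite mulrBr qq mulrBl mul1r -mulrA yy mulr1 addrC subrK.
  by rewrite (le_trans (rnormD _ _))// lerD// rnorm_mul3// rnormC.
rewrite invfM mulrA mulfVK ?gt_eqF// in qb.
by move: (rnorm q') qb => n qb; lra.
Qed.

End OneParameter.

Lemma sandwich_sub (K : pzRingType) (a f g e e' : K) : a = f * g -> a = g * f ->
  f * e' * f - a * e * a = f * (e' - g * e * g) * f.
Proof. by move=> afg agf; rewrite mulrBr mulrBl {1}afg agf !mulrA. Qed.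

Lemma sandwich_inv (K : pzRingType) (f g e y : K) : f * g = 1 -> g * f = 1 ->
  f * (g * e * g - y) * f = e - f * y * f.
Proof. by move=> fg gf; rewrite mulrBr mulrBl !mulrA fg mul1r -(mulrA e) gf mulr1. Qed.

Section Sandwich.
Variables (R : realType) (V : completeNormedModType R[i]).
Variable dot : {dot V for @Num.conj R[i]}.
Hypothesis hV : hilbert_norm dot.
Variable H : set (bop V).
Hypotheses (Hsub : real_subspace H) (Hclosed : seq_closed H).
Hypothesis Hsa : forall x, H x -> sadj dot x.
Hypothesis Htriple : forall x y, H x -> H y -> H (commutator x (commutator x y)).
Implicit Types (x y h k a w : bop V) (s t : R).

(** [log_lip] at k = 0: a bound on h from bounds on e^h and e^(-h) alone. *)
Lemma rnorm_log_le h (c b : R) : 0 <= c -> sadj dot h ->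
  rnorm (op_exp (- h)) <= expR c -> rnorm (op_exp h) <= b ->
  rnorm h <= expR c * (b + 1).
Proof.
move=> c0 hh hc hb; rewrite -[h]subr0.
have e0 : rnorm (op_exp (- (0 : bop V))) <= expR c.
  rewrite oppr0 op_exp0; apply: (le_trans (rnorm1_le _)).
  by rewrite -expR0 ler_expR.
apply: (le_trans (log_lip hV c0 hh (sadj0 dot) hc e0)).
rewrite op_exp0; apply: ler_wpM2l; first exact: expR_ge0.
by apply: (le_trans (rnormB _ _)); apply: lerD => //; exact: rnorm1_le.
Qed.

(** A priori bound for the Euler polygon: as long as e^(-s x) e^h e^(-s x) is
    close to e^y, the vertex h stays in a ball that depends only on x and y. *)
Lemma pull_back_bound x y h s : `|s| <= 1 -> sadj dot h ->
  rnorm (op_exp ((- s)%:C *: x) * op_exp h * op_exp ((- s)%:C *: x) - op_exp y)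
    <= (2 * expR (rnorm y))^-1 ->
  rnorm (op_exp (- h)) <= expR (2 * rnorm x + rnorm y + 1) /\
  rnorm h <= expR (2 * rnorm x + rnorm y + 1) *
     (expR (rnorm x) * (expR (rnorm y) + 1) * expR (rnorm x) + 1).
Proof.
move=> s1 hh hq; set F := fun t => op_exp (t%:C *: x).
have Fs := rnorm_exp_line x s1.
have s1' : `|- s| <= 1 by rewrite normrN.
have FNs := rnorm_exp_line x s1'.
have F1 : F s * F (- s) = 1 by rewrite /F op_exp_line subrr scale0r op_exp0.
have F2 : F (- s) * F s = 1 by rewrite /F op_exp_line addNr scale0r op_exp0.
pose q := F (- s) * op_exp h * F (- s).
pose q' := F s * op_exp (- h) * F s.
have qq : q' * q = 1.
  rewrite /q /q' !mulrA -[_ * F s * F (- s)]mulrA F1 mulr1.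
  by rewrite -[_ * _ * op_exp h]mulrA op_expVl mulr1 F1.
have yb : rnorm (op_exp (- y)) <= expR (rnorm y).
  by apply: (le_trans (rnorm_exp _)); rewrite rnormN.
have q'b := rnorm_inv_near (expR_gt0 _) qq (op_expVr y) yb hq.
have hc : rnorm (op_exp (- h)) <= expR (2 * rnorm x + rnorm y + 1).
  have -> : op_exp (- h) = F (- s) * q' * F (- s).
    by rewrite /q' !mulrA F2 mul1r -mulrA F1 mulr1.
  rewrite (le_trans (rnorm_mul3 FNs q'b FNs))//.
  have -> : expR (2 * rnorm x + rnorm y + 1) = expR (rnorm x) * (expR 1 * expR (rnorm y)) * expR (rnorm x).
    by rewrite -!expRD; congr expR; ring.
  rewrite ler_wpM2r ?expR_ge0// ler_wpM2l ?expR_ge0// ler_wpM2r ?expR_ge0//.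
  by rewrite (le_trans _ (expR_ge1Dx 1)).
split=> //; apply: rnorm_log_le => //.
  by rewrite !addr_ge0 ?mulr_ge0 ?rnorm_ge0.
have -> : op_exp h = F s * q * F s.
  by rewrite /q !mulrA F1 mul1r -mulrA F2 mulr1.
apply: (rnorm_mul3 Fs _ Fs).
rewrite -[q](subrK (op_exp y)) addrC (le_trans (rnormD _ _))// lerD ?rnorm_exp//.
rewrite (le_trans hq)// invf_le1 ?mulr_gt0 ?expR_gt0//.
have y1 : 1 <= expR (rnorm y) by rewrite -expR0 ler_expR rnorm_ge0.
by rewrite (le_trans y1)// ler_peMl ?expR_ge0 ?ler1n.
Qed.

(** Euler polygons with n + 1 steps for log (e^(t x) e^y e^(t x)). The errors are
    compared after pulling back by e^(-t x), where they add up linearly: n + 1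
    steps of error O(1 / (n + 1)^2). *)
Lemma euler_polygon x y : H x -> H y -> exists c K : R, 0 <= c /\
  exists n0 : nat, forall n, (n0 <= n)%N -> exists2 h, H h &
    [/\ rnorm h <= c, rnorm (op_exp (- h)) <= expR c &
        rnorm (op_exp h - op_exp x * op_exp y * op_exp x) <= K / n.+1%:R].
Proof.
move=> hx hy; pose c0 := 2 * rnorm x + rnorm y + 1.
pose r := expR c0 * (expR (rnorm x) * (expR (rnorm y) + 1) * expR (rnorm x) + 1).
have [C C0 step] := euler_step hV Hsub Hclosed Hsa Htriple r.
pose K := expR (rnorm x) * (C * rnorm x ^+ 2) * expR (rnorm x).
have K0 : 0 <= K by rewrite !mulr_ge0 ?expR_ge0 ?rnorm_ge0.
have c00 : 0 <= c0 by rewrite !addr_ge0 ?mulr_ge0 ?rnorm_ge0.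
have r0 : 0 <= r.
  by rewrite mulr_ge0 ?expR_ge0// addr_ge0// !mulr_ge0 ?expR_ge0// addr_ge0// expR_ge0.
exists (c0 + r), (expR (rnorm x) * K * expR (rnorm x)); split; first exact: addr_ge0.
(* beyond B the step length |x| / N is at most 1 and the accumulated error K / N
   stays in the range of [pull_back_bound] *)
pose B := rnorm x + K * (2 * expR (rnorm y)).
have B0 : 0 <= K * (2 * expR (rnorm y)).
  by apply: mulr_ge0 => //; apply: mulr_ge0 => //; exact: expR_ge0.
exists (Num.truncn B) => n nB.
have Bn : B < n.+1%:R.
  by apply: (lt_le_trans (truncnS_gt B)); rewrite ler_nat ltnS.
set N : R := n.+1%:R in Bn *; have N0 : 0 < N by rewrite ltr0n.
have xN : rnorm ((N^-1)%:C *: x) <= 1.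
  rewrite rnormZ gtr0_norm ?invr_gt0// mulrC ler_pdivrMr// mul1r.
  by rewrite (le_trans _ (ltW Bn))// /B lerDl.
have KN : K / N <= (2 * expR (rnorm y))^-1.
  rewrite ler_pdivrMr// mulrC ler_pdivlMr ?mulr_gt0 ?expR_gt0//.
  by rewrite (le_trans _ (ltW Bn))// /B lerDr rnorm_ge0.
pose s j : R := j%:R / N.
have s1 j : (j <= n.+1)%N -> `|s j| <= 1.
  move=> jn; rewrite ger0_norm; last by rewrite divr_ge0// ltW.
  by rewrite ler_pdivrMr// mul1r ler_nat.
pose F t := op_exp (t%:C *: x).
pose pb j h := F (- s j) * op_exp h * F (- s j).
have small j : (j <= n.+1)%N -> j%:R * (K / N ^+ 2) <= K / N.
  move=> jn; have -> : j%:R * (K / N ^+ 2) = s j * (K / N).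
    by rewrite /s expr2 invfM; ring.
  rewrite ler_piMl//; first by rewrite divr_ge0// ltW.
  by rewrite (le_trans (ler_norm _))// s1.
have main j : (j <= n.+1)%N ->
    exists2 h, H h & rnorm (pb j h - op_exp y) <= j%:R * (K / N ^+ 2).
  elim: j => [_|j IH jn].
    exists y => //; rewrite /pb /F /s mul0r oppr0 scale0r op_exp0 mul1r mulr1.
    by rewrite subrr rnorm0 mul0r.
  have [h hh hb] := IH (ltnW jn).
  have hb' := le_trans hb (le_trans (small j (ltnW jn)) KN).
  have [_ hr] := pull_back_bound (s1 j (ltnW jn)) (Hsa hh) hb'.
  have ha : H ((N^-1)%:C *: x) by exact: subspaceZ.
  have [h' hh' est] := step h _ hh hr ha xN.
  exists h' => //.
  have sS : - s j = - s j.+1 + N^-1.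
    by rewrite /s -natr1 mulrDl mul1r opprD subrK.
  have sS' : - s j = N^-1 - s j.+1 by rewrite addrC.
  have FS : F (- s j) = F (- s j.+1) * op_exp ((N^-1)%:C *: x).
    by rewrite /F op_exp_line -sS.
  have FS' : F (- s j) = op_exp ((N^-1)%:C *: x) * F (- s j.+1).
    by rewrite /F op_exp_line -sS'.
  have -> : pb j.+1 h' - op_exp y = (pb j.+1 h' - pb j h) + (pb j h - op_exp y).
    by rewrite addrA subrK.
  rewrite -natr1 mulrDl mul1r addrC (le_trans (rnormD _ _))// lerD//.
  have -> : pb j.+1 h' - pb j h = F (- s j.+1) *
     (op_exp h' - op_exp ((N^-1)%:C *: x) * op_exp h * op_exp ((N^-1)%:C *: x)) * F (- s j.+1).
    exact: (sandwich_sub _ _ FS FS').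
  have FN : rnorm (F (- s j.+1)) <= expR (rnorm x) by apply: rnorm_exp_line; rewrite normrN s1.
  rewrite (le_trans (rnorm_mul3 FN est FN))//.
  rewrite rnormZ gtr0_norm ?invr_gt0//.
  by rewrite le_eqVlt; apply/orP; left; apply/eqP; rewrite /K exprMn expr2 invfM; ring.
have [h hh hb] := main n.+1 (leqnn _).
have sn : s n.+1 = 1 by rewrite /s mulfV ?gt_eqF.
have hb1 := le_trans hb (small _ (leqnn _)).
have [hc hr] := pull_back_bound (s1 _ (leqnn _)) (Hsa hh) (le_trans hb1 KN).
exists h => //; split.
- by rewrite (le_trans hr)// lerDr.
- by rewrite (le_trans hc)// ler_expR lerDl.
have -> : op_exp h - op_exp x * op_exp y * op_exp x = op_exp x * (pb n.+1 h - op_exp y) * op_exp x.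
  have Fn : F (- s n.+1) = op_exp (- x) by rewrite /F sn rmorphN1 scaleN1r.
  by rewrite /pb Fn (sandwich_inv _ _ (op_expVr x) (op_expVl x)).
by rewrite (le_trans (rnorm_mul3 (rnorm_exp x) hb1 (rnorm_exp x)))// !mulrA mulrAC.
Qed.

Theorem exp_sandwich x y : H x -> H y ->
  exists2 z, H z & op_exp z = op_exp x * op_exp y * op_exp x.
Proof.
move=> hx hy; have [c [K [c0 [n0 poly]]]] := euler_polygon hx hy.
set p := op_exp x * _ * _ in poly *.
have /choice[h hP] n : exists h, H h /\ [/\ rnorm h <= c, rnorm (op_exp (- h)) <= expR c &
        rnorm (op_exp h - p) <= K / (n0 + n).+1%:R].
  by have [h hh hb] := poly _ (leq_addr n n0); exists h.
have Hh n : H (h n) by case: (hP n).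
have K0 : 0 <= K.
  have [_ [_ _ h0]] := hP 0%N.
  by have := le_trans (rnorm_ge0 _) h0; rewrite pmulr_lge0 ?invr_gt0 ?ltr0n.
pose e n : R := K / (n0 + n).+1%:R.
have e0 : e @ \oo --> (0 : R).
  rewrite -(mulr0 K); apply: cvgM; first exact: cvg_cst.
  have := @cvg_harmonic R; rewrite -(cvg_shiftn n0).
  by apply: cvg_trans; apply: near_eq_cvg; near=> n; rewrite /= addnC.
have ele n m : (n <= m)%N -> e m <= e n.
  move=> nm; rewrite /e ler_wpM2l// lef_pV2 ?posrE ?ltr0n// ler_nat ltnS leq_add2l//.
pose b n := expR c * (2 * e n).
have b0 : b @ \oo --> (0 : R).
  rewrite -(mulr0 (expR c)); apply: cvgM; first exact: cvg_cst.
  by rewrite -(mulr0 2); apply: cvgM => //; exact: cvg_cst.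
have hb n m : (n <= m)%N -> rnorm (h m - h n) <= b n.
  move=> nm; have [hm [_ cm em]] := hP m; have [hn [_ cn en]] := hP n.
  rewrite (le_trans (log_lip hV c0 (Hsa hm) (Hsa hn) cm cn))// ler_wpM2l ?expR_ge0//.
  rewrite -[op_exp (h m)](subrK p) -addrA.
  apply: (le_trans (rnormD _ _)); rewrite [in leRHS]mulr2n [in leRHS]mulrDl [in leRHS]mul1r.
  by apply: lerD; [exact: le_trans em (ele _ _ nm)|rewrite rnormC; exact: en].
have /cvg_ex[z hz] := rnorm_complete hb b0.
have Hz : H z by exact: Hclosed hz.
exists z => //.
have zc : rnorm z <= c by apply: (rnorm_lim_le hz) => n; case: (hP n) => _ [].
apply/eqP; rewrite -subr_eq0; apply/eqP/rnorm_le0.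
apply: (@le_add_cvg0 _ _ _ (fun n => expR c * rnorm (h n - z) + e n)) => [|n].
  rewrite -[0](addr0 0); apply: cvgD => //.
  rewrite -(mulr0 (expR c)); apply: cvgM; first exact: cvg_cst.
  by apply/cvg_rnormP.
rewrite add0r -[op_exp z](subrK (op_exp (h n))) -addrA.
apply: (le_trans (rnormD _ _)).
have [_ [hc _ hn]] := hP n.
by apply: lerD; [rewrite rnormC; exact: rnorm_exp_sub|exact: hn].
Unshelve. all: by end_near. Qed.

End Sandwich.

(** * From convexity to double commutators *)

Lemma sandwich_square (K : pzRingType) (k k' x : K) : k' * k = 1 -> k * k' = 1 ->
  k' * ((k * x * k) * (k * x * k)) * k' = x * (k * k) * x.
Proof. by move=> h h'; rewrite !mulrA h mul1r -(mulrA _ k k') h' mulr1. Qed.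

Lemma even_part_half (R : realType) (E : lmodType R[i]) (a b o u q : E) :
  (2^-1 : R)%:C *: ((a - o - u - q) + (b - o - - u - q)) =
  (2^-1 : R)%:C *: (a + b) - o - q.
Proof.
rewrite addrACA [X in X + _]addrACA [X in X + _ + _]addrACA -!opprD addrN subr0.
by rewrite -!mulr2n !scalerBr !scaler_half_double.
Qed.

Lemma sinhc_taylor (R : realType) (V : completeNormedModType R[i]) (x : bop V) (t : R) :
  0 <= t <= 1 ->
  rnorm (sinhc (t%:C *: x) - 1 - (t ^+ 2 / 6)%:C *: ad x ^+ 2)
    <= t ^+ 3 * (rnorm (ad x) ^+ 3 * expR (rnorm (ad x))).
Proof.
move=> /andP[t0 t1]; rewrite /sinhc adZ; set U := t%:C *: ad x.
have UE : (t ^+ 2 / 6)%:C *: ad x ^+ 2 = (6^-1)%:C *: U ^+ 2.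
  by rewrite /U bop_exprZn -rmorphXn scalerA -rmorphM mulrC.
have aux (S : bop (bop V)) : rnorm S = t * rnorm (ad x) ->
    rnorm (phi S - 1 - (2^-1)%:C *: S - (6^-1)%:C *: S ^+ 2)
    <= t ^+ 3 * (rnorm (ad x) ^+ 3 * expR (rnorm (ad x))).
  move=> SE; apply: (le_trans (rnorm_phi_taylor S)); rewrite SE exprMn -mulrA.
  apply: ler_wpM2l; first exact: exprn_ge0.
  apply: ler_wpM2l; first by apply: exprn_ge0; exact: rnorm_ge0.
  by rewrite ler_expR; apply: ler_piMl => //; exact: rnorm_ge0.
have U1 : rnorm U = t * rnorm (ad x) by rewrite rnormZ ger0_norm.
have h1 := aux U U1.
have U2 : rnorm (- U) = t * rnorm (ad x) by rewrite rnormN.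
have := aux (- U) U2; rewrite sqrrN scalerN => h2.
have -> : (2^-1)%:C *: (phi U + phi (- U)) - 1 - (t ^+ 2 / 6)%:C *: ad x ^+ 2 =
  (2^-1)%:C *: ((phi U - 1 - (2^-1)%:C *: U - (6^-1)%:C *: U ^+ 2) +
     (phi (- U) - 1 - - ((2^-1)%:C *: U) - (6^-1)%:C *: U ^+ 2)).
  by rewrite even_part_half UE.
rewrite rnormZ ger0_norm ?invr_ge0// mulrC ler_pdivrMr ?ltr0n//.
apply: (le_trans (rnormD _ _)); apply: (le_trans (lerD h1 h2)).
by rewrite [leRHS]mulr_natr mulr2n.
Qed.

Lemma inverse_unique (K : pzRingType) (a b c : K) : b * a = 1 -> a * c = 1 -> b = c.
Proof. by move=> ba ac; rewrite -[b]mulr1 -ac mulrA ba mul1r. Qed.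

Lemma mul1rE (R : realType) (W : normedModType R[i]) (v : W) : (1 : bop W) v = v.
Proof. by []. Qed.

Section Geodesics.
Variables (R : realType) (V : completeNormedModType R[i]).
Variable dot : {dot V for @Num.conj R[i]}.
Hypothesis hV : hilbert_norm dot.
Implicit Types (x y z h k w : bop V) (s t : R).
Local Notation sadj := (sadj dot).

Lemma sadj_subspace : real_subspace [set x | sadj x].
Proof.
split; first exact: sadj0; first by move=> x y; exact: sadjD.
by move=> t x; exact: sadjZ.
Qed.

Lemma sadj_seq_closed : seq_closed [set x | sadj x].
Proof. by move=> u l; exact: sadj_lim. Qed.

Lemma sadj_triple x y : sadj x -> sadj y -> sadj (commutator x (commutator x y)).
Proof.
move=> hx hy; rewrite /commutator mulrBr mulrBl opprB !mulrA addrA.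
have hxx : sadj (x * x) by rewrite -expr2; exact: sadjX.
have hxyx := sadj_mul3 hx hy.
rewrite [x * x * y - _ + _]addrAC -[y * x * x]mulrA.
by apply: sadjB => //; apply: sadjB => //; exact: sadj_jordan.
Qed.

Lemma geodesic_exp x y z t : sadj x -> sadj z ->
  op_exp z = op_exp ((- 2^-1)%:C *: x) * op_exp y * op_exp ((- 2^-1)%:C *: x) ->
  geodesic dot (op_exp x) (op_exp y) t =
  op_exp ((2^-1)%:C *: x) * op_exp (t%:C *: z) * op_exp ((2^-1)%:C *: x).
Proof.
by move=> hx hz zE; rewrite /geodesic /op_pow (op_logK hV hx) -zE (op_logK hV hz).
Qed.

Variable H : set (bop V).
Hypotheses (Hsub : real_subspace H) (Hclosed : seq_closed H).
Hypothesis Hsa : forall x, H x -> sadj x.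

(** The geodesic from e^(-y) to e^x at t = 2. The selfadjoint logarithm z in it
    exists by [exp_sandwich] for the space of all selfadjoint operators. *)
Lemma convex_sandwich :
  (forall p q, (@op_exp R V @` H) p -> (@op_exp R V @` H) q ->
     forall t, (@op_exp R V @` H) (geodesic dot p q t)) ->
  forall x y, H x -> H y ->
  exists2 g, H g & op_exp g = op_exp x * op_exp y * op_exp x.
Proof.
move=> conv x y hx hy.
have hNy : H (- y) by exact: subspaceN.
pose k := (- 2^-1)%:C *: (- y).
have hk : sadj k by apply: sadjZ; exact: Hsa.
have [z hz zE] := exp_sandwich hV sadj_subspace sadj_seq_closed (fun _ => id)
  sadj_triple hk (Hsa hx).
have [g hg gE] := conv _ _ (ex_intro2 _ _ _ hNy erefl) (ex_intro2 _ _ _ hx erefl) 2.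
exists g => //; rewrite gE (geodesic_exp 2 (Hsa hNy) hz zE).
have kN : (2^-1)%:C *: (- y) = - k by rewrite /k rmorphN scaleNr opprK.
have ky : op_exp k * op_exp k = op_exp y.
  by rewrite -op_expD// -scalerDr -opprD rmorphN scaleNr scalerN opprK -mulr2n scaler_half_double.
have z2 : op_exp ((2 : R)%:C *: z) = op_exp z * op_exp z.
  by rewrite -op_expD// mulr2n rmorphD rmorph1 scalerDl scale1r.
rewrite kN z2 zE -/k -ky.
exact: sandwich_square (op_expVl k) (op_expVr k).
Qed.

Section Tangent.
Hypothesis sandwich : forall x y, H x -> H y ->
  exists2 g, H g & op_exp g = op_exp x * op_exp y * op_exp x.

(** w is the derivative at t = 0 of g(t) = log (e^k e^(t y) e^k), which is in H:
    to first order e^(g(t)) and e^(2k + t w) both are e^(2k) + t e^k y e^k, and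
    [log_lip] transfers this to the logarithms. *)
Lemma sinhc_preimage k y w : H k -> H y -> sadj w -> sinhc k w = y -> H w.
Proof.
move=> hk hy hw wy.
have hsk := Hsa hk.
pose t n : R := 2^-1 ^+ n.
have t0 n : 0 < t n by rewrite exprn_gt0 ?invr_gt0.
have t1 n : t n <= 1 by rewrite exprn_ile1 ?invr_ge0// invf_le1// ler1n.
have /choice[g hg] n : exists g, H g /\
    op_exp g = op_exp k * op_exp ((t n)%:C *: y) * op_exp k.
  by have [g] := sandwich hk (subspaceZ Hsub (t n) hy); exists g.
pose r := rnorm (k + k) + rnorm w.
pose A := rnorm w ^+ 2 * expR r +
  expR (rnorm k) * (rnorm y ^+ 2 * expR (rnorm y)) * expR (rnorm k).
pose c := rnorm k + rnorm y + rnorm k + r.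
have c0 : 0 <= c by rewrite !addr_ge0 ?rnorm_ge0.
pose u n := ((t n)^-1)%:C *: (g n - (k + k)).
apply: (Hclosed (u := u)) => [n|].
  by apply: subspaceZ => //; apply: subspaceB => //; [case: (hg n)|exact: subspaceD].
apply: (@cvg_rnorm_squeeze _ _ _ _ (fun n => t n * (expR c * A))) => [n|]; last first.
  by rewrite -(mul0r (expR c * A)); apply: cvgM; [exact: cvg_half|exact: cvg_cst].
have [Hg gE] := hg n; rewrite /u; move: (t n) (t0 n) (t1 n) gE => s s0 s1 gE.
have sw : rnorm (s%:C *: w) <= rnorm w.
  by rewrite rnormZ gtr0_norm// ler_piMl ?rnorm_ge0.
have sy : rnorm (s%:C *: y) <= rnorm y.
  by rewrite rnormZ gtr0_norm// ler_piMl ?rnorm_ge0.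
have hr : rnorm (k + k) + rnorm (s%:C *: w) <= r by rewrite lerD2l.
have T1 := op_exp_taylor hr.
have SE : sinhc k (s%:C *: w) = s%:C *: y by rewrite -wy linearZ.
rewrite SE -bop_scalerAr -bop_scalerAl in T1.
have T2 : rnorm (op_exp (g n) - op_exp (k + k) - s%:C *: (op_exp k * y * op_exp k)) <=
   s ^+ 2 * (expR (rnorm k) * (rnorm y ^+ 2 * expR (rnorm y)) * expR (rnorm k)).
  have -> : op_exp (g n) - op_exp (k + k) - s%:C *: (op_exp k * y * op_exp k) =
     op_exp k * (op_exp (s%:C *: y) - 1 - s%:C *: y) * op_exp k.
    by rewrite gE op_expD// !mulrBr !mulrBl mulr1 -bop_scalerAr -bop_scalerAl.
  have T3 : rnorm (op_exp (s%:C *: y) - 1 - s%:C *: y) <= s ^+ 2 * (rnorm y ^+ 2 * expR (rnorm y)).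
    apply: (le_trans (rnorm_exp_sub1x _)); rewrite mulrA -exprMn.
    rewrite ler_pM ?exprn_ge0 ?rnorm_ge0 ?expR_ge0 ?ler_expR//.
    by rewrite rnormZ gtr0_norm.
  apply: (le_trans (rnorm_mul3 (rnorm_exp k) T3 (rnorm_exp k))).
  by rewrite le_eqVlt; apply/orP; left; apply/eqP; ring.
have T4 : rnorm (op_exp (g n) - op_exp (k + k + s%:C *: w)) <= s ^+ 2 * A.
  have -> : op_exp (g n) - op_exp (k + k + s%:C *: w) =
     (op_exp (g n) - op_exp (k + k) - s%:C *: (op_exp k * y * op_exp k)) -
     (op_exp (k + k + s%:C *: w) - op_exp (k + k) - s%:C *: (op_exp k * y * op_exp k)).
    by rewrite -!(addrA _ (- op_exp (k + k))) -!opprD opprB addrA subrK.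
  apply: (le_trans (rnormB _ _)); rewrite /A mulrDr addrC; apply: lerD => //.
  by apply: (le_trans T1); rewrite rnormZ gtr0_norm// exprMn -mulrA.
have gc : rnorm (op_exp (- g n)) <= expR c.
  have -> : op_exp (- g n) = op_exp (- k) * op_exp (- (s%:C *: y)) * op_exp (- k).
    apply: (@inverse_unique _ (op_exp (g n))); first exact: op_expVl.
    rewrite gE !mulrA -(mulrA _ (op_exp k)) op_expVr mulr1.
    by rewrite -(mulrA _ (op_exp (s%:C *: y))) op_expVr mulr1 op_expVr.
  have kc : rnorm (op_exp (- k)) <= expR (rnorm k).
    by apply: (le_trans (rnorm_exp _)); rewrite rnormN.
  have yc : rnorm (op_exp (- (s%:C *: y))) <= expR (rnorm y).
    by apply: (le_trans (rnorm_exp _)); rewrite rnormN ler_expR.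
  apply: (le_trans (rnorm_mul3 kc yc kc)); rewrite -!expRD ler_expR lerDl.
  by rewrite addr_ge0 ?rnorm_ge0.
have wc : rnorm (op_exp (- (k + k + s%:C *: w))) <= expR c.
  apply: (le_trans (rnorm_exp _)); rewrite rnormN ler_expR.
  apply: (le_trans (rnormD _ _)); apply: (le_trans hr); rewrite lerDr.
  by rewrite !addr_ge0 ?rnorm_ge0.
have hkw : sadj (k + k + s%:C *: w) by apply: sadjD; [exact: sadjD|exact: sadjZ].
have lip := log_lip hV c0 (Hsa Hg) hkw gc wc.
have -> : (s^-1)%:C *: (g n - (k + k)) - w = (s^-1)%:C *: (g n - (k + k + s%:C *: w)).
  rewrite (opprD (k + k)) (addrA (g n)) [RHS]scalerBr; congr (_ - _).
  by rewrite scalerA -rmorphM mulVf ?gt_eqF// rmorph1 scale1r.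
rewrite rnormZ gtr0_norm ?invr_gt0// mulrC ler_pdivrMr//.
apply: (le_trans lip).
have -> : s * (expR c * A) * s = expR c * (s ^+ 2 * A) by ring.
by apply: ler_wpM2l; [exact: expR_ge0|].
Qed.

(** For w_s in H with S_(s x) w_s = y, the vector (6 / s^2) (y - w_s) is in H and
    tends to (ad x)^2 y. *)
Lemma sandwich_triple x y : H x -> H y -> H (commutator x (commutator x y)).
Proof.
move=> hx hy.
pose t n : R := 2^-1 ^+ n.
have t0 n : 0 < t n by rewrite exprn_gt0 ?invr_gt0.
have t1 n : t n <= 1 by rewrite exprn_ile1 ?invr_ge0// invf_le1// ler1n.
have htx n : H ((t n)%:C *: x) by exact: subspaceZ.
have /choice[w hw] n : exists w, sadj w /\ sinhc ((t n)%:C *: x) w = y.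
  have [w hw we] := sinhc_onto hV sadj_subspace sadj_seq_closed (fun _ => id)
    sadj_triple (Hsa (htx n)) (Hsa hy).
  by exists w.
have Hw n : H (w n) by case: (hw n) => sw; exact: sinhc_preimage.
pose T := ad x; pose N := rnorm T; pose M := N ^+ 3 * expR N.
pose B := expR (4 * rnorm x + 1) * rnorm y.
have N0 : 0 <= N by exact: rnorm_ge0.
have M0 : 0 <= M by rewrite mulr_ge0 ?exprn_ge0 ?expR_ge0.
have B0 : 0 <= B by rewrite mulr_ge0 ?rnorm_ge0 ?expR_ge0.
pose v n := (6 / t n ^+ 2)%:C *: (y - w n).
pose K := N ^+ 2 * ((N ^+ 2 + M) * B) + 6 * M * B.
apply: (Hclosed (u := v)) => [n|].
  by apply: subspaceZ => //; exact: subspaceB.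
apply: (@cvg_rnorm_squeeze _ _ _ _ (fun n => t n * K)) => [n|]; last first.
  by rewrite -(mul0r K); apply: cvgM; [exact: cvg_half|exact: cvg_cst].
have [sw wE] := hw n.
have wB : rnorm (w n) <= B.
  apply: (le_trans (sinhc_lower hV (Hsa (htx n)) sw)); rewrite wE.
  apply: ler_wpM2r; first exact: rnorm_ge0.
  rewrite ler_expR lerD2r ler_wpM2l// rnormZ gtr0_norm// ler_piMl ?rnorm_ge0//.
have s01 : 0 <= t n <= 1 by rewrite t1 ltW.
have tay := sinhc_taylor x s01.
rewrite /v; move: (w n) (t n) (t0 n) (t1 n) wE wB tay => z s s0 s1 zE zB.
set rho := (X in rnorm X <= _) => tay.
have yz : y - z = (s ^+ 2 / 6)%:C *: (T ^+ 2) z + rho z.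
  by rewrite /rho !bop_subE zE bop_scaleE mul1rE subrKC.
have rz : rnorm (rho z) <= s ^+ 3 * M * B.
  by apply: (le_trans (rnorm_apply _ _)); rewrite ler_pM ?rnorm_ge0.
have TT u : rnorm ((T ^+ 2) u) <= N ^+ 2 * rnorm u.
  apply: (le_trans (rnorm_apply _ _)); apply: ler_wpM2r; first exact: rnorm_ge0.
  exact: rnormX.
have yz_le : rnorm (y - z) <= s * ((N ^+ 2 + M) * B).
  rewrite yz; apply: (le_trans (rnormD _ _)).
  have -> : s * ((N ^+ 2 + M) * B) = s * N ^+ 2 * B + s * M * B by ring.
  have ss : s ^+ 2 <= s by rewrite expr2 ler_piMl// ltW.
  have sss : s ^+ 3 <= s by rewrite exprS ler_piMr ?exprn_ile1// ltW.
  have s20 : 0 <= s ^+ 2 by rewrite exprn_ge0// ltW.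
  apply: lerD.
    rewrite rnormZ ger0_norm; last by rewrite divr_ge0.
    rewrite -mulrA; apply: ler_pM; rewrite ?divr_ge0 ?rnorm_ge0//.
      by rewrite ler_pdivrMr//; lra.
    by apply: (le_trans (TT z)); rewrite ler_wpM2l ?exprn_ge0.
  by apply: (le_trans rz); rewrite !ler_wpM2r.
have s2 : s ^+ 2 != 0 by rewrite expf_neq0// gt_eqF.
have -> : (6 / s ^+ 2)%:C *: (y - z) - commutator x (commutator x y)
   = - (T ^+ 2) (y - z) + (6 / s ^+ 2)%:C *: rho z.
  have -> : commutator x (commutator x y) = (T ^+ 2) y by rewrite expr2.
  rewrite {1}yz scalerDr scalerA -rmorphM.
  have -> : 6 / s ^+ 2 * (s ^+ 2 / 6) = 1 :> R by rewrite mulrA mulfVK// mulfV// pnatr_eq0.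
  have TB : (T ^+ 2) (y - z) = (T ^+ 2) y - (T ^+ 2) z by exact: raddfB.
  by rewrite rmorph1 scale1r TB (opprB ((T ^+ 2) y)) addrAC.
have s30 : 6 / s ^+ 2 * (s ^+ 3 * M * B) = s * (6 * M * B).
  have sN0 : s != 0 by rewrite gt_eqF.
  by field.
rewrite /K mulrDr; apply: (le_trans (rnormD _ _)); apply: lerD.
  rewrite rnormN; apply: (le_trans (TT _)); rewrite mulrCA.
  by apply: ler_wpM2l => //; rewrite exprn_ge0.
have p0 : 0 <= 6 / s ^+ 2 by rewrite divr_ge0// exprn_ge0// ltW.
by rewrite rnormZ ger0_norm// -s30; apply: ler_wpM2l.
Qed.

End Tangent.
End Geodesics.

Theorem theorem4p4 (R : realType) (V : completeNormedModType R[i])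
    (dot : {dot V for @Num.conj R[i]}) (hV : hilbert_norm dot)
    (A : set (bop V)) (hA : von_neumann_algebra dot A)
    (tau : bop V -> R[i]) (htau : normal_faithful_tracial_state dot A tau)
    (H : set (bop V)) (Hsub : real_subspace H)
    (Hsa : H `<=` selfadjoint dot A) (Hclosed : closed H) :
  geodesically_convex dot A (@op_exp R V @` H) <->
  (forall x y : bop V, H x -> H y -> H (commutator x (commutator x y))).
Proof.
have Hlim := closed_seq_closed Hclosed.
have Hadj x : H x -> sadj dot x by move=> /Hsa[].
split=> [[_ conv] x y hx hy|Htriple].
  apply: (sandwich_triple hV Hsub Hlim Hadj _ hx hy).
  exact: (convex_sandwich hV Hsub Hadj conv).
split=> [_ [x hx <-]|_ _ [x hx <-] [y hy <-] t]; first by exists x => //; exact: Hsa.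
have sandwich := exp_sandwich hV Hsub Hlim Hadj Htriple.
have [z hz zE] := sandwich _ _ (subspaceZ Hsub (- 2^-1) hx) hy.
have [g hg gE] := sandwich _ _ (subspaceZ Hsub 2^-1 hx) (subspaceZ Hsub t hz).
by exists g => //; rewrite gE (geodesic_exp hV t (Hadj _ hx) (Hadj _ hz) zE).
Qed.
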